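(* Let $d\geq 4$ be even and let $k$ be a totally real number field. Then there exists a diagonal surface of degree $d$ over $k$ which fails the Hasse principle for lines.
   Context: A diagonal surface of degree $d$ over a field $k$ is the surface $S \subset \mathbb{P}^3_k$ given by $a_0x_0^d + a_1x_1^d + a_2x_2^d + a_3x_3^d = 0$ with $a_0,a_1,a_2,a_3 \in k^*$. For a field extension $K/k$, a line on $S$ over $K$ is a line in $\mathbb{P}^3$ defined over $K$ and contained in $S$. A surface $S$ over a number field $k$ fails the Hasse principle for lines if $S$ contains a line over the completion $k_v$ for every place $v$ of $k$ but contains no line over $k$. *)

(* Defs.v *)
From HB Require Import structures.
From mathcomp Require Import all_boot all_order all_algebra all_field.
From mathcomp Require Import reals complex.

Set Implicit Arguments.
Unset Strict Implicit.
Unset Printing Implicit Defensive.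

Import Order.TTheory GRing.Theory Num.Theory.
Local Open Scope ring_scope.

Record absolute_value (R : realType) (k : fieldType) := AbsoluteValue {
  absv :> k -> R;
  absv_ge0 : forall x, 0 <= absv x;
  absv_eq0 : forall x, absv x = 0 <-> x = 0;
  absvM : forall x y, absv (x * y) = absv x * absv y;
  ler_absvD : forall x y, absv (x + y) <= absv x + absv y
}.

(* A place of k is an equivalence class of nontrivial absolute values.
   Equivalent absolute values are powers of one another, hence have the same
   Cauchy sequences and the same completion field, so quantifying over places
   v and their completions k_v amounts to quantifying over all nontrivial
   absolute values and their completions. *)
Definition nontrivial (R : realType) (k : fieldType)
    (v : absolute_value R k) : Prop :=
  exists2 x : k, x != 0 & v x != 1.

Definition cauchy_seq (R : realType) (K : fieldType)
    (w : absolute_value R K) (u : nat -> K) : Prop :=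
  forall e : R, 0 < e ->
    exists N : nat, forall m n : nat,
      (N <= m)%N -> (N <= n)%N -> w (u m - u n) < e.

Definition converges_to (R : realType) (K : fieldType)
    (w : absolute_value R K) (u : nat -> K) (l : K) : Prop :=
  forall e : R, 0 < e ->
    exists N : nat, forall n : nat, (N <= n)%N -> w (u n - l) < e.

(* A model of k_v; any two are uniquely isomorphic as valued extensions of
   k. *)
Record completion (R : realType) (k : fieldType) (v : absolute_value R k) :=
  Completion {
    compl_field :> fieldType;
    compl_absv : absolute_value R compl_field;
    compl_emb : {rmorphism k -> compl_field};
    compl_absv_emb : forall x : k, compl_absv (compl_emb x) = v x;
    compl_dense : forall (y : compl_field) (e : R), 0 < e ->
      exists x : k, compl_absv (y - compl_emb x) < e;
    compl_complete : forall u : nat -> compl_field,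
      cauchy_seq compl_absv u -> exists l, converges_to compl_absv u l
  }.

Definition totally_real (R : realType) (k : fieldExtType rat) : Prop :=
  forall (s : {rmorphism k -> R[i]%C}) (x : k), complex.Im (s x) = 0.

(* The surface a_0 x_0^d + a_1 x_1^d + a_2 x_2^d + a_3 x_3^d = 0 in P^3. *)
Record diagonal_surface (k : fieldType) (d : nat) := DiagonalSurface {
  dcoef :> 'I_4 -> k;
  dcoef_neq0 : forall i, dcoef i != 0
}.

(* x is a vector of homogeneous coordinates over an extension f : k -> E. *)
Definition on_surface (k E : fieldType) (f : {rmorphism k -> E}) (d : nat)
    (S : diagonal_surface k d) (x : 'rV[E]_4) : Prop :=
  \sum_(i < 4) f (S i) * x 0 i ^+ d = 0.

(* A line in P^3 over K is the row space of a 2 x 4 matrix of rank 2.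
   Containment in S is containment of varieties, i.e., of E-points for all
   field extensions E of K. *)
Definition contains_line_over (k K : fieldType) (f : {rmorphism k -> K})
    (d : nat) (S : diagonal_surface k d) : Prop :=
  exists2 L : 'M[K]_(2, 4), \rank L = 2%N &
    forall (E : fieldType) (g : {rmorphism K -> E}) (x : 'rV[E]_4),
      (x <= map_mx g L)%MS -> on_surface (g \o f) S x.

Definition fails_Hasse_principle_for_lines (R : realType) (k : fieldType)
    (d : nat) (S : diagonal_surface k d) : Prop :=
  (forall v : absolute_value R k, nontrivial v ->
     forall kv : completion v, contains_line_over (compl_emb kv) S) /\
  ~ contains_line_over (@idfun k) S.

(* Main.v *)
Require Import Defs.
From HB Require Import structures.
From mathcomp Require Import all_boot all_order all_algebra all_field.
From mathcomp Require Import reals complex.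
From mathcomp Require Import all_solvable ring lra zify.
From mathcomp Require boolp.

Set Implicit Arguments.
Unset Strict Implicit.
Unset Printing Implicit Defensive.

Import Order.TTheory GRing.Theory Num.Theory.
Local Open Scope ring_scope.

(* A line on a diagonal surface of degree d >= 4 in characteristic 0 is
   x_i = lam x_l, x_j = mu x_m with a_i lam^d + a_l = a_j mu^d + a_m = 0.  For the
   coefficients (1, c/a, -a, -c) with a^2 = g^d there is hence a line over K iff one of
   a, c, -c/a is a d-th power in K.
   If 4 | d, take a = (1 + zeta)^d, where zeta is a root of unity of 2-power order s
   in k(i); a lies in k, and is not a d-th power there if s is as large as possible.
   Take c = n^(d/2), where n is a Fermat number.  If -1 is not a square in k_v, then
   n or -n is a square in k_v.
   If d = 2m with m odd, let q be a prime factor of m, and take a = delta^m where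
   k(sqrt delta) is the quadratic subextension of k(zeta_q)/k, which exists because k
   is real, and c = n^(d/q), where n is the value at q^q of the q-th cyclotomic
   polynomial.  If k_v contains no primitive q-th root of unity, then n is a q-th power
   in k_v.
   As n is rational, these local statements are about Q_p and R, and only need that
   k_v is a complete valued field of characteristic 0. *)

(** * Roots of unity and powers modulo a prime *)

Section ModPrime.
Variable p : nat.
Hypothesis p_prime : prime p.

Lemma Fp_nat_eq0 (n : nat) : (n%:R == 0 :> 'F_p) = (p %| n)%N.
Proof. by rewrite -(dvdn_pcharf (pchar_Fp p_prime)). Qed.

Lemma Fp_int_eq0 (z : int) : (z%:~R == 0 :> 'F_p) = (p %| z)%Z.
Proof.
case: z => n; first exact: Fp_nat_eq0.
by rewrite NegzE rmorphN oppr_eq0; apply: Fp_nat_eq0.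
Qed.

Lemma Fp_exists_int (x : 'F_p) : exists z : int, z%:~R = x.
Proof. by exists (nat_of_ord x)%:Z; exact: natr_Zp. Qed.

Lemma Fp_prim_root : exists z : 'F_p, p.-1.-primitive_root z.
Proof.
have p1 := prime_gt1 p_prime; have p0 := prime_gt0 p_prime.
pose rs := enum (predC1 (0 : 'F_p)).
have srs : size rs = p.-1 by rewrite -cardE cardC1 card_Fp.
have rs1 : all p.-1.-unity_root rs.
  apply/allP => x; rewrite mem_enum inE => x0.
  apply/unity_rootP; apply: (mulfI x0); rewrite -exprS prednK // mulr1.
  by have := expf_card x; rewrite card_Fp.
have /hasP[z _ zp] : has p.-1.-primitive_root rs.
  by apply: has_prim_root; rewrite ?srs ?enum_uniq // -subn1 subn_gt0.
by exists z.
Qed.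

Lemma Fp_expr_pred (x : 'F_p) : x != 0 -> x ^+ p.-1 = 1.
Proof.
move=> x0; apply: (mulfI x0); rewrite -exprS prednK ?prime_gt0 // mulr1.
by have := expf_card x; rewrite card_Fp.
Qed.

Lemma primitive_root_mod : exists g : nat, ~~ (p %| g)%N /\
    forall b, ~~ (p %| b)%N -> exists i, (b = g ^ i %[mod p])%N.
Proof.
have p0 := prime_gt0 p_prime.
have eqmod (m n : nat) : m%:R = n%:R :> 'F_p -> (m = n %[mod p])%N.
  wlog le : m n / (n <= m)%N => [W|].
    by case/orP: (leq_total n m) => [/W//|/W + e] => /(_ (esym e)).
  by move=> e; apply/eqP; rewrite eqn_mod_dvd // -Fp_nat_eq0 natrB // e subrr.
have [z zp] := Fp_prim_root; exists (nat_of_ord z); split.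
  rewrite -Fp_nat_eq0 natr_Zp; apply/eqP => z0; have := prim_expr_order zp.
  by rewrite z0 expr0n -subn1 subn_eq0 leqNgt prime_gt1 //= => /eqP; rewrite eq_sym oner_eq0.
move=> b; rewrite -Fp_nat_eq0 => b0.
have [i bi] := prim_rootP zp (Fp_expr_pred b0).
by exists i; apply: eqmod; rewrite natrX natr_Zp bi.
Qed.

Lemma unity_root_mod (m : nat) : (1 < m)%N -> (m %| p.-1)%N ->
  exists x : int, (p %| x ^+ m - 1)%Z /\ ~~ (p %| x - 1)%Z.
Proof.
move=> m1 mp; have [z zp] := Fp_prim_root.
have [x ex] := Fp_exists_int (z ^+ (p.-1 %/ m)).
exists x; rewrite -!Fp_int_eq0 !rmorphB rmorphXn /= ex; split.
  by rewrite -exprM divnK // prim_expr_order // subrr.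
rewrite subr_eq0 -(prim_order_dvd zp) gtnNdvd //.
  by rewrite divn_gt0 ?(ltnW m1) // dvdn_leq // -subn1 subn_gt0 prime_gt1.
by rewrite ltn_Pdiv // -subn1 subn_gt0 prime_gt1.
Qed.

(** The nonzero residues are the powers of [z], and [z ^+ h = -1] where p - 1 = 2h. If h is even, -1
    is an even power of [z]. If h is odd, a change of sign changes the parity of the exponent, so
    one of n and -n is an even power. *)
Lemma opp_square_mod : odd p ->
  (exists x : int, (p %| x ^+ 2 - (-1))%Z) \/
  forall n : int, exists x : int, (p %| x ^+ 2 - n)%Z \/ (p %| x ^+ 2 - (- n))%Z.
Proof.
move=> po; have [z zp] := Fp_prim_root.
have p2 : (2 < p)%N by have := prime_gt1 p_prime; case: (p) po => [|[|[|]]].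
pose h := p./2; have hp : p.-1 = (2 * h)%N.
  by rewrite -{1}(odd_double_half p) po mul2n.
have h0 : (0 < h)%N by move: p2; rewrite -(odd_double_half p) po /h; case: (p./2).
have zh : z ^+ h = -1.
  have : (z ^+ h) ^+ 2 = 1 by rewrite -exprM mulnC -hp prim_expr_order.
  move/eqP; rewrite sqrf_eq1 => /orP[|/eqP //].
  by rewrite -(prim_order_dvd zp) hp gtnNdvd // ltn_Pmull.
case: (boolP (odd h)) => oh; last first.
  left; have [x ex] := Fp_exists_int (z ^+ h./2); exists x.
  rewrite -Fp_int_eq0 rmorphB rmorphXn rmorphN /= ex -exprM muln2.
  have -> : h./2.*2 = h by rewrite -[RHS]odd_double_half (negbTE oh).
  by rewrite zh subrr.
right=> n; have [n0|n0] := eqVneq (n%:~R : 'F_p) 0.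
  by exists 0; left; rewrite -Fp_int_eq0 rmorphB /= n0 subr0 rmorphXn rmorph0 expr0n.
have [[i /= ip] ni] := prim_rootP zp (Fp_expr_pred n0).
have even j : ~~ odd j -> exists x : int, x%:~R ^+ 2 = z ^+ j.
  move=> oj; have [x ex] := Fp_exists_int (z ^+ j./2); exists x.
  rewrite ex -exprM muln2; congr (_ ^+ _).
  by rewrite -[RHS]odd_double_half (negbTE oj).
case: (boolP (odd i)) => oi; last first.
  have [x ex] := even i oi; exists x; left.
  by rewrite -Fp_int_eq0 rmorphB rmorphXn /= ex ni subrr.
have [|x ex] := even (i + h)%N; first by rewrite oddD oi oh.
exists x; right; rewrite -Fp_int_eq0 rmorphB rmorphN rmorphXn /= ex ni exprD zh.
by rewrite mulrN1 subrr.
Qed.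

Section NoUnityRoots.
Variable q : nat.
Hypothesis q_prime : prime q.
Hypothesis qp : ~~ (q %| p.-1)%N.

(** As q is prime to p - 1, some a inverts q modulo p - 1, and the a-th power undoes the q-th power
    on nonzero residues. *)
Lemma Fp_expr_bezout (n : 'F_p) : n != 0 -> exists a, (n ^+ q) ^+ a = n.
Proof.
move=> n0; have cop : coprime q p.-1 by rewrite prime_coprime.
have [a b e _] := egcdnP p.-1 (prime_gt0 q_prime).
exists a; rewrite -exprM mulnC e (eqP cop) exprD mulnC exprM Fp_expr_pred //.
by rewrite expr1n mul1r.
Qed.

Lemma power_mod (n : int) : exists x : int, (p %| x ^+ q - n)%Z.
Proof.
have [n0|n0] := eqVneq (n%:~R : 'F_p) 0.
  exists 0; rewrite -Fp_int_eq0 rmorphB /= n0 subr0 rmorphXn rmorph0 expr0n.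
  by rewrite eqn0Ngt prime_gt0.
have [a ea] := Fp_expr_bezout n0; exists (n ^+ a).
by rewrite -Fp_int_eq0 rmorphB !rmorphXn /= -exprM mulnC exprM ea subrr.
Qed.

Lemma unity_root_mod_eq1 (x : int) : (p %| x ^+ q - 1)%Z -> (p %| x - 1)%Z.
Proof.
rewrite -!Fp_int_eq0 !rmorphB rmorphXn rmorph1 !subr_eq0 /= => /eqP xq.
have x0 : (x%:~R : 'F_p) != 0.
  apply/eqP => x0; have := oner_neq0 'F_p.
  by rewrite -xq x0 expr0n eqn0Ngt prime_gt0 // eqxx.
by have [a] := Fp_expr_bezout x0; rewrite xq expr1n => <-.
Qed.

End NoUnityRoots.
End ModPrime.

(** * Absolute values and roots in completions *)

Lemma bernoulli_ge (R : realDomainType) (h : R) n : 0 <= h -> 1 + n%:R * h <= (1 + h) ^+ n.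
Proof.
move=> h0; elim: n => [|n IH]; first by rewrite mul0r addr0.
rewrite exprS -natr1.
have : (1 + h) * (1 + n%:R * h) <= (1 + h) * (1 + h) ^+ n.
  by rewrite ler_wpM2l // addr_ge0.
apply: le_trans; have : 0 <= n%:R * h * h by rewrite !mulr_ge0.
by nra.
Qed.

Lemma expr_unbounded (R : realType) (x B : R) : 1 < x -> exists n, B < x ^+ n.
Proof.
move=> x1; have h0 : 0 < x - 1 by rewrite subr_gt0.
pose N := Num.bound `|B / (x - 1)|; exists N.
have := bernoulli_ge N (ltW h0).
rewrite (_ : 1 + (x - 1) = x); last by ring.
apply: lt_le_trans; apply: (@lt_trans _ _ (N%:R * (x - 1))); last by rewrite ltrDr.
rewrite -ltr_pdivrMr //; apply: le_lt_trans (ler_norm _) _.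
exact: archi_boundP (normr_ge0 _).
Qed.

Lemma geometric_small (R : realType) (C r e : R) : 0 <= r -> r < 1 -> 0 < e ->
  exists N, forall n, (N <= n)%N -> C * r ^+ n < e.
Proof.
move=> r0 r1 e0; have [->|rn0] := eqVneq r 0.
  by exists 1%N => -[|n] // _; rewrite expr0n mulr0.
have rp : 0 < r by rewrite lt_def rn0.
have r1' : 1 < r^-1 by rewrite invf_gt1.
have [N HN] := expr_unbounded (`|C| / e) r1'.
exists N => n Nn; apply: (@le_lt_trans _ _ (`|C| * r ^+ N)).
  apply: (@le_trans _ _ (`|C| * r ^+ n)); first by rewrite ler_wpM2r ?exprn_ge0 ?ler_norm.
  by rewrite ler_wpM2l // ler_wiXn2l // ltW.
move: HN; rewrite exprVn ltr_pdivrMr // => HN.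
by rewrite -ltr_pdivlMr ?exprn_gt0 // mulrC.
Qed.

Section AbsoluteValue.
Variables (R : realType) (K : fieldType) (w : absolute_value R K).

Lemma absv0 : w 0 = 0. Proof. by apply/absv_eq0. Qed.

Lemma absv1 : w 1 = 1.
Proof.
have n0 : w 1 != 0 by apply/eqP => /absv_eq0/eqP; rewrite oner_eq0.
by apply: (mulIf n0); rewrite -absvM !mul1r.
Qed.

Lemma absvX x n : w (x ^+ n) = w x ^+ n.
Proof. by elim: n => [|n IH]; rewrite ?expr0 ?absv1 // !exprS absvM IH. Qed.

Lemma absvN x : w (- x) = w x.
Proof.
apply/eqP; rewrite -(eqrXn2 (n := 2)) ?absv_ge0 //.
by rewrite -!absvX sqrrN.
Qed.

Lemma absv_gt0 x : x != 0 -> 0 < w x.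
Proof.
by move=> x0; rewrite lt_def absv_ge0 andbT; apply/eqP => /absv_eq0/eqP; apply/negP.
Qed.

Lemma absvV x : w x^-1 = (w x)^-1.
Proof.
have [->|x0] := eqVneq x 0; first by rewrite invr0 absv0 invr0.
have wx0 : w x != 0 by rewrite gt_eqF ?absv_gt0.
by apply: (mulIf wx0); rewrite -absvM !mulVf // absv1.
Qed.

Lemma absv_sum (I : Type) (s : seq I) (P : pred I) (F : I -> K) :
  w (\sum_(i <- s | P i) F i) <= \sum_(i <- s | P i) w (F i).
Proof.
elim/big_ind2: _ => [|x a y b xa yb|//]; first by rewrite absv0.
by rewrite (le_trans (ler_absvD _ _ _)) // lerD.
Qed.

Lemma absv_distC x y : w (x - y) = w (y - x).
Proof. by rewrite -absvN opprB. Qed.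

(** The steps are dominated by a geometric series, so the sequence converges; taking m-th powers is
    Lipschitz on bounded sets, so the limit is an m-th root of [u]. Both the dyadic approximations
    at archimedean places and the p-adic ones have this form. *)
Lemma root_of_approximations (m : nat) (u : K) (x : nat -> K) (C r : R) :
  (forall s : nat -> K, cauchy_seq w s -> exists l, converges_to w s l) ->
  0 <= r -> r < 1 ->
  (forall n, w (x n.+1 - x n) <= C * r ^+ n) ->
  (forall n, w (x n ^+ m - u) <= C * r ^+ n) ->
  exists2 y, y ^+ m = u & converges_to w x y.
Proof.
move=> compl r0 r1 dx xu.
have r1' : 0 < 1 - r by rewrite subr_gt0.
have C0 : 0 <= C.
  by have := le_trans (absv_ge0 _ _) (dx 0%N); rewrite expr0 mulr1.
have tail n j : w (x (n + j)%N - x n) <= C / (1 - r) * (r ^+ n - r ^+ (n + j)).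
  elim: j => [|j IH]; first by rewrite addn0 !subrr absv0 mulr0.
  rewrite addnS (_ : x _ - _ = (x (n + j).+1 - x (n + j)%N) + (x (n + j)%N - x n)); last by ring.
  apply: le_trans (ler_absvD _ _ _) _; apply: le_trans (lerD (dx _) IH) _.
  rewrite le_eqVlt; apply/orP; left; apply/eqP; rewrite (exprS r (n + j)).
  by field; rewrite gt_eqF.
have tail2 n N : (N <= n)%N -> w (x n - x N) <= C / (1 - r) * r ^+ N.
  move=> Nn; rewrite -(subnKC Nn); apply: le_trans (tail _ _) _.
  apply: ler_wpM2l; first by rewrite divr_ge0 // ltW.
  by rewrite gerBl exprn_ge0.
have [y Hy] : exists y, converges_to w x y.
  apply: compl => e e0; have e2 : 0 < e / 2 by rewrite divr_gt0.
  have [N HN] := geometric_small (C / (1 - r)) r0 r1 e2.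
  exists N => i j Ni Nj.
  rewrite (_ : x i - x j = (x i - x N) + (x N - x j)); last by ring.
  apply: le_lt_trans (ler_absvD _ _ _) _; rewrite (absv_distC (x N)).
  have := HN N (leqnn N); have := tail2 _ _ Ni; have := tail2 _ _ Nj; lra.
exists y => //; apply/eqP; rewrite -subr_eq0; apply/eqP/(absv_eq0 w)/eqP.
rewrite eq_le absv_ge0 andbT; apply: contraT; rewrite -ltNge => wy0.
(* [B] bounds [y] and the late [x n], and has monotone powers because it is at least 1; [M] is then
   a Lipschitz constant for the m-th power. *)
pose B := w y + 1; have B1 : 1 <= B by rewrite lerDr absv_ge0.
have B0 : 0 <= B by apply: le_trans B1.
pose M := m%:R * B ^+ m.
have M0 : 0 <= M by rewrite mulr_ge0 ?exprn_ge0.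
pose e := w (y ^+ m - u).
have e2 : 0 < e / 2 by rewrite divr_gt0.
have e3 : 0 < e / 2 / (M + 1) by rewrite divr_gt0 // ltr_wpDl.
have [N1 HN1] := Hy _ e3; have [N2 HN2] := Hy _ ltr01.
have [N3 HN3] := geometric_small C r0 r1 e2.
pose n := maxn N1 (maxn N2 N3).
have yn : w (y - x n) < e / 2 / (M + 1) by rewrite absv_distC HN1 ?leq_maxl.
have xB : w (x n) <= B.
  rewrite (_ : x n = y + (x n - y)); last by ring.
  apply: le_trans (ler_absvD _ _ _) _; rewrite lerD2l ltW // HN2 //.
  by rewrite /n !leq_max leqnn !orbT.
have un : w (x n ^+ m - u) < e / 2.
  by apply: le_lt_trans (xu n) _; apply: HN3; rewrite /n !leq_max leqnn !orbT.
have : e < e / 2 + e / 2.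
  apply: (@le_lt_trans _ _ (w (y ^+ m - x n ^+ m) + w (x n ^+ m - u))).
    by apply: le_trans (ler_absvD _ _ _); rewrite addrA subrK.
  apply: ler_ltD => //.
  rewrite subrXX absvM; apply: (@le_trans _ _ (e / 2 / (M + 1) * M)).
    apply: ler_pM; rewrite ?absv_ge0 //; first exact: ltW.
    apply: le_trans (absv_sum _ _ _) _; have -> : M = \sum_(i < m) B ^+ m.
      by rewrite sumr_const card_ord /M mulr_natl.
    apply: ler_sum => i _; rewrite absvM !absvX.
    apply: (@le_trans _ _ (B ^+ (m.-1 - i) * B ^+ i)).
      by apply: ler_pM; rewrite ?exprn_ge0 ?absv_ge0 // lerXn2r ?nnegrE ?absv_ge0 // lerDl.
    have im : (i <= m.-1)%N by rewrite -ltnS (ltn_predK (ltn_ord i)).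
    by rewrite -exprD ler_weXn2l // subnK // leq_pred.
  have M1 : 0 < M + 1 by rewrite ltr_wpDl.
  rewrite mulrAC ler_pdivrMr // ler_wpM2l ?lerDl //.
  exact: ltW.
by rewrite (_ : e / 2 + e / 2 = e) ?ltxx //; field.
Qed.


(** Each of the L binary digits of n adds at most 1, since doubling does not increase [w]. *)
Lemma absv_nat_le2 L n : (n < 2 ^ L)%N -> w 2 <= 1 -> w n%:R <= L%:R.
Proof.
elim: L n => [|L IH] n; first by rewrite expn0 ltnS leqn0 => /eqP -> _; rewrite absv0.
move=> nL w2; rewrite -(odd_double_half n) natrD -mul2n natrM -[L.+1%:R]natr1 addrC.
apply: le_trans (ler_absvD _ _ _) _; apply: lerD; last first.
  by case: (odd n); rewrite ?absv1 ?absv0.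
rewrite absvM -[L%:R]mul1r; apply: ler_pM; rewrite ?absv_ge0 //.
by apply: IH => //; rewrite ltn_half_double -mul2n -expnS.
Qed.

(** If [w n%:R = 1 + h] with h > 0, then [w] of n^(2j) grows quadratically in j by Bernoulli's
    inequality, whereas the number of binary digits of n^(2j), which bounds it, is linear in j. *)
Lemma absv_nat_le1 n : w 2 <= 1 -> w n%:R <= 1.
Proof.
move=> w2; rewrite leNgt; apply/negP => wn.
have h0 : 0 < w n%:R - 1 by rewrite subr_gt0.
have [L nL] : exists L, (n < 2 ^ L)%N by exists n; rewrite ltn_expl.
pose h := w n%:R - 1.
have lin j : (1 + j%:R * h) ^+ 2 <= (j * 2 * L).+1%:R.
  apply: (@le_trans _ _ ((w n%:R ^+ j) ^+ 2)).
    rewrite lerXn2r ?nnegrE ?exprn_ge0 ?absv_ge0 ?addr_ge0 ?mulr_ge0 ?ler0n ?(ltW h0) //.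
    by have := bernoulli_ge j (ltW h0); rewrite (_ : 1 + (_ - 1) = w n%:R) //; ring.
  rewrite -exprM -absvX -natrX; apply: absv_nat_le2 => //.
  rewrite expnS (mulnC (j * 2)%N) expnM; apply: (@leq_ltn_trans ((2 ^ L) ^ (j * 2))%N).
    have [->|j0] := posnP j; first by rewrite mul0n !expn0 exp1n.
    by rewrite -expnM leq_exp2r ?muln_gt0 ?j0 // ltnW.
  by rewrite -expnM ltn_Pmull // !expn_gt0.
pose j := (Num.bound `|(2 * L)%:R / h ^+ 2|).+1.
have : (2 * L)%:R < j%:R * h ^+ 2.
  rewrite -ltr_pdivrMr ?exprn_gt0 //; apply: le_lt_trans (ler_norm _) _.
  apply: lt_le_trans (archi_boundP (normr_ge0 _)) _; by rewrite ler_nat.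
rewrite natrM => jL; have j0 : 0 < j%:R :> R by rewrite ltr0n.
have : j%:R * (2 * L%:R) < j%:R * (j%:R * h ^+ 2) by rewrite ltr_pM2l.
have := lin j; rewrite -natr1 !natrM; have : 0 < j%:R * h by rewrite mulr_gt0.
by nra.
Qed.

(** Summing over binary digits bounds [w n%:R] by the geometric sum of the first L powers of
    [w 2]. *)
Lemma absv_nat_le_expn L n : (n < 2 ^ L)%N -> 1 < w 2 -> w n%:R * (w 2 - 1) <= w 2 ^+ L - 1.
Proof.
move=> + w2; elim: L n => [|L IH] n.
  by rewrite expn0 ltnS leqn0 => /eqP ->; rewrite absv0 mul0r expr0 subrr.
move=> nL; rewrite -(odd_double_half n) natrD -mul2n natrM addrC.
have h0 : 0 <= w 2 - 1 by rewrite subr_ge0 ltW.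
apply: (@le_trans _ _ ((w 2 * w n./2%:R + 1) * (w 2 - 1))).
  apply: ler_wpM2r => //; apply: le_trans (ler_absvD _ _ _) _.
  by rewrite absvM lerD2l; case: (odd n); rewrite ?absv1 ?absv0.
have /IH : (n./2 < 2 ^ L)%N by rewrite ltn_half_double -mul2n -expnS.
by rewrite exprS; have := w2; nra.
Qed.

End AbsoluteValue.

(** * Roots of integers in complete valued fields *)

Definition complete (R : realType) (K : fieldType) (w : absolute_value R K) :=
  forall s : nat -> K, cauchy_seq w s -> exists l, converges_to w s l.

(* floor (2 ^ j * u ^ (1/m)), where P0 is the integral part of u ^ (1/m) *)
Fixpoint binary_root (m u P0 j : nat) : nat :=
  if j is j'.+1 then
    let P := binary_root m u P0 j' in
    if ((P.*2.+1) ^ m <= u * (2 ^ j) ^ m)%N then P.*2.+1 else P.*2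
  else P0.

Lemma binary_rootP (m u P0 j : nat) : (0 < m)%N -> (P0 ^ m <= u < P0.+1 ^ m)%N ->
  ((binary_root m u P0 j) ^ m <= u * (2 ^ j) ^ m < (binary_root m u P0 j).+1 ^ m)%N.
Proof.
move=> m0 H0; elim: j => [|j IH]; first by rewrite expn0 exp1n muln1.
rewrite /=; set P := binary_root _ _ _ _ in IH *.
have E : (u * (2 ^ j.+1) ^ m = 2 ^ m * (u * (2 ^ j) ^ m))%N.
  by rewrite expnS expnMn mulnCA.
case: ifP => [le1|/negbT]; last rewrite -ltnNge => lt1.
  rewrite le1 /= E -[P.*2.+2](doubleS P) -mul2n expnMn ltn_pmul2l ?expn_gt0 //.
  by case/andP: IH.
by rewrite lt1 andbT E -mul2n expnMn leq_pmul2l ?expn_gt0 //; case/andP: IH.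
Qed.

Lemma expnS_le P m : (P.+1 ^ m.+1 <= P ^ m.+1 + m.+1 * P.+1 ^ m)%N.
Proof.
elim: m => [|m IH]; first by rewrite !expn1 expn0; lia.
rewrite (expnS P.+1 m.+1) (expnS P m.+1).
have e : (P * (m.+1 * P.+1 ^ m) <= m.+1 * P.+1 ^ m.+1)%N.
  by rewrite mulnCA leq_pmul2l // expnS leq_mul2r leqnSn orbT.
have := leq_mul (leqnn P) IH; rewrite mulnDr.
by rewrite !mulSn in e *; lia.
Qed.

Section Roots.
Variables (R : realType) (K : fieldType) (w : absolute_value R K).
Hypothesis w_complete : complete w.

(** The truncations [P j / 2 ^+ j] of the binary expansion of the real root converge in [K] too. All
    estimates rest on [1 < w 2]: integers are bounded through their number of binary digits. *)
Lemma archimedean_root (m u : nat) : 1 < w 2 -> (0 < m)%N -> exists y : K, y ^+ m = u%:R.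
Proof.
move=> w2; case: m => // m _.
have w20 : 0 < w 2 by rewrite (lt_trans ltr01).
have w20' : 0 < w 2 - 1 by rewrite subr_gt0.
have two0 : 2 != 0 :> K by apply: contraTneq w20 => ->; rewrite absv0 ltxx.
have [P0 HP0] : exists P0, (P0 ^ m.+1 <= u < P0.+1 ^ m.+1)%N.
  have ex : exists P, (P ^ m.+1 <= u)%N by exists 0%N; rewrite exp0n.
  have bd P : (P ^ m.+1 <= u)%N -> (P <= u)%N.
    by apply: leq_trans; rewrite -[X in (X <= _)%N]expn1; case: P => // P; rewrite leq_pexp2l.
  exists (ex_maxn ex bd); case: ex_maxnP => P -> max /=.
  by rewrite ltnNge; apply/negP => /max; rewrite ltnn.
pose P := binary_root m.+1 u P0.
have HP j : (P j ^ m.+1 <= u * (2 ^ j) ^ m.+1 < (P j).+1 ^ m.+1)%N by apply: binary_rootP.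
pose x j : K := (P j)%:R / 2 ^+ j.
pose r := (w 2)^-1.
have r0 : 0 <= r by rewrite invr_ge0 ltW.
have r1 : r < 1 by rewrite invf_lt1.
(* From P j + 1 <= (u + 1) 2^j, the defect [D] below, which is less than (m + 1)(P j + 1)^m, has at
   most A + j m binary digits. *)
pose A := (m.+1 * (u.+1) ^ m)%N.
pose C := w 2 ^+ A / (w 2 - 1) + 1.
have C1 : 1 <= C by rewrite lerDr divr_ge0 ?exprn_ge0 ?ltW.
have [] := @root_of_approximations R K w m.+1 u%:R x C r w_complete r0 r1; last first.
- by move=> y yu _; exists y.
- move=> j; have /andP[le1 lt1] := HP j.
  have e1 : x j ^+ m.+1 - u%:R = - ((u * (2 ^ j) ^ m.+1 - P j ^ m.+1)%N%:R / (2 ^+ j) ^+ m.+1).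
    rewrite natrB // natrM !natrX /x expr_div_n.
    by field; rewrite -exprM expf_neq0.
  rewrite e1 absvN absvM absvV !absvX.
  set D := (_ - _)%N.
  have PD : (D < 2 ^ (A + j * m))%N.
    have PU : (P j <= u * 2 ^ j)%N.
      rewrite -(@leq_exp2r _ _ m.+1) // (leq_trans le1) // expnMn leq_mul2r.
      by apply/orP; right; rewrite -[X in (X <= _)%N]expn1; case: (u) => // v; rewrite leq_pexp2l.
    have PU1 : ((P j).+1 <= u.+1 * 2 ^ j)%N.
      by rewrite mulSn; have : (0 < 2 ^ j)%N by [rewrite expn_gt0]; lia.
    apply: (@leq_ltn_trans (m.+1 * (P j).+1 ^ m)%N).
      by rewrite /D; have := expnS_le (P j) m; lia.
    apply: (@leq_ltn_trans (m.+1 * (u.+1 * 2 ^ j) ^ m)%N).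
      have [->|m0] := posnP m; first by rewrite !expn0.
      by rewrite leq_pmul2l // leq_exp2r.
    by rewrite expnMn mulnA expnD -expnM ltn_pmul2r ?expn_gt0 // ltn_expl.
  have wD := absv_nat_le_expn PD w2.
  rewrite ler_pdivrMr ?exprn_gt0 //.
  apply: (@le_trans _ _ (w 2 ^+ (A + j * m) / (w 2 - 1))).
    by rewrite ler_pdivlMr // (le_trans wD) // gerBl.
  have -> : C * r ^+ j * (w 2 ^+ j) ^+ m.+1 = C * w 2 ^+ (j * m).
    rewrite /r -exprM mulnS exprD -mulrA exprVn; congr (_ * _).
    by rewrite mulKf // expf_neq0 // gt_eqF.
  rewrite exprD mulrAC; apply: ler_wpM2r; first by rewrite exprn_ge0 ?ltW.
  by rewrite lerDl.
move=> j; apply: (@le_trans _ _ (r ^+ j.+1)); last first.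
  apply: (@le_trans _ _ (r ^+ j)); first by rewrite ler_wiXn2l // ltW.
  by rewrite ler_peMl // exprn_ge0.
have -> : x j.+1 - x j = (((P j).*2.+1 ^ m.+1 <= u * (2 ^ j.+1) ^ m.+1)%N)%:R / 2 ^+ j.+1.
  rewrite /x; have -> : P j.+1 = (((P j).*2.+1 ^ m.+1 <= u * (2 ^ j.+1) ^ m.+1)%N + (P j).*2)%N.
    by rewrite {1}/P /= -/(P j); case: ifP.
  rewrite natrD -mul2n natrM exprS.
  by field; rewrite two0 expf_neq0.
rewrite absvM absvV absvX /r exprVn; case: (_ <= _)%N; rewrite ?absv1 ?mul1r //.
by rewrite absv0 mul0r invr_ge0 exprn_ge0 // ltW.
Qed.

Section NonArchimedean.
Hypothesis w2 : w 2 <= 1.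

Lemma absv_int_le1 (z : int) : w z%:~R <= 1.
Proof.
by case: z => n; rewrite ?NegzE ?rmorphN ?absvN; apply: absv_nat_le1.
Qed.

Variable p : nat.
Hypothesis p_prime : prime p.
Hypothesis wp : w p%:R < 1.

Lemma absv_dvd (E : nat) (z : int) : ((p%:Z ^+ E) %| z)%Z -> w z%:~R <= w p%:R ^+ E.
Proof.
case/dvdzP => y ->; rewrite rmorphM rmorphXn absvM absvX /=.
by rewrite ler_piMl ?exprn_ge0 ?absv_ge0 // absv_int_le1.
Qed.

(** In a Bezout relation 1 = a p^N + b z with [w] of p^N below 1/2, the term b z must contribute at
    least 1/2. The bound is 1/2 because only the triangle inequality is used. *)
Lemma absv_ndvd (z : int) : ~~ (p %| z)%Z -> 1 / 2 <= w z%:~R.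
Proof.
move=> pz; rewrite leNgt; apply/negP => wz.
have h : 0 < 1 / 2 :> R by rewrite divr_gt0.
have [N HN] := geometric_small 1 (absv_ge0 w _) wp h.
have := HN N (leqnn N); rewrite mul1r => pN.
have cop : coprimez (p%:Z ^+ N) z.
  by rewrite /coprimez gcdzC -/(coprimez z _) coprimezXr // coprimezE coprime_sym prime_coprime // -[(p %| _)%N]/(p%:Z %| z)%Z.
have /coprimezP[[a b] /= ab] := cop.
have /(congr1 (fun y : int => w y%:~R)) := ab.
rewrite rmorphD !rmorphM rmorphXn /= absv1 => e.
have : 1 <= w (a%:~R * p%:R ^+ N) + w (b%:~R * z%:~R).
  by rewrite -{1}e; apply: ler_absvD.
rewrite !absvM absvX.
have : w a%:~R * w p%:R ^+ N <= w p%:R ^+ N.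
  by rewrite ler_piMl ?exprn_ge0 ?absv_ge0 // absv_int_le1.
have : w b%:~R * w z%:~R <= w z%:~R by rewrite ler_piMl ?absv_ge0 // absv_int_le1.
by lra.
Qed.


Lemma expr_taylor (A : comNzRingType) (x h : A) m :
  exists c, (x + h) ^+ m = x ^+ m + m%:R * x ^+ m.-1 * h + h ^+ 2 * c.
Proof.
elim: m => [|[|m] [c IH]].
- by exists 0; rewrite !expr0; ring.
- by exists 0; rewrite !expr1 expr0; ring.
- exists (m.+1%:R * x ^+ m + c * (x + h)).
  by rewrite exprSr IH /= !exprS -!natr1; ring.
Qed.

(** A Newton step: the derivative m x^(m-1) is p^s times a unit modulo p, so a correction divisible
    by p^(s+1+k) gains one factor p, while the quadratic term is divisible by p^(2s+2+2k). *)
Lemma hensel_step (m s m' k : nat) (x u : int) :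
  m = (p ^ s * m')%N -> ~~ (p %| m')%N -> ~~ (p %| x)%Z ->
  ((p%:Z ^+ (2 * s + 1 + k)) %| x ^+ m - u)%Z ->
  exists x', ((p%:Z ^+ (2 * s + 1 + k.+1)) %| x' ^+ m - u)%Z /\
             ((p%:Z ^+ k.+1) %| x' - x)%Z.
Proof.
move=> em pm px /dvdzP[r er].
have cop : coprimez (m'%:Z * x ^+ m.-1) p%:Z.
  rewrite coprimezMl; apply/andP; split.
    by rewrite coprimezE /= coprime_sym prime_coprime.
  by rewrite coprimez_sym coprimezXr // coprimezE prime_coprime.
have /coprimezP[[a b] /= ab] := cop.
(* [a] inverts m' x^(m-1) modulo p and [r] is the error divided by p^(2s+1+k), so the linear term
   cancels the error modulo the next power. *)
pose h : int := p%:Z ^+ (s + 1 + k) * (- r * a).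
exists (x + h); split; last first.
  rewrite addrAC subrr add0r /h dvdz_mulr // (_ : (s + 1 + k = k.+1 + s)%N); last by lia.
  by rewrite exprD dvdz_mulr.
have [c ->] := expr_taylor x h m.
have -> : x ^+ m + m%:R * x ^+ m.-1 * h + h ^+ 2 * c - u =
    p%:Z ^+ (2 * s + 1 + k.+1) * (r * b + p%:Z ^+ k * (r * a) ^+ 2 * c).
  have -> : x ^+ m + m%:R * x ^+ m.-1 * h + h ^+ 2 * c - u =
     (x ^+ m - u) + m%:R * x ^+ m.-1 * h + h ^+ 2 * c by ring.
  rewrite er /h.
  have -> : (m%:R : int) = p%:Z ^+ s * m'%:Z by rewrite em natrM natrX !natz.
  have -> : r = r * (a * (m'%:Z * x ^+ m.-1) + b * p%:Z) by rewrite ab mulr1.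
  rewrite ab mulr1.
  rewrite (_ : (2 * s + 1 + k.+1 = s + s + 2 + k)%N); last by lia.
  rewrite (_ : (2 * s + 1 + k = s + s + 1 + k)%N); last by lia.
  have eb : b * p%:Z = 1 - a * (m'%:Z * x ^+ m.-1) by rewrite -ab; ring.
  rewrite !exprD !expr1 !expr2.
  set P := p%:Z ^+ s; set Q := p%:Z ^+ k.
  have -> : r * (P * P * p%:Z * Q) = r * (a * (m'%:Z * x ^+ m.-1) + b * p%:Z) * (P * P * p%:Z * Q).
    by rewrite ab mulr1.
  by ring.
by rewrite dvdz_mulr.
Qed.

(** The approximating integers are returned with the root: they stay congruent to [x0], which later
    tells a root of unity apart from 1. *)
Lemma hensel_root (m s m' : nat) (x0 u : int) :
  m = (p ^ s * m')%N -> ~~ (p %| m')%N -> ~~ (p %| x0)%Z ->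
  ((p%:Z ^+ (2 * s + 1)) %| x0 ^+ m - u)%Z ->
  exists2 y : K, y ^+ m = u%:~R & exists2 X : nat -> int,
    converges_to w (fun n => (X n)%:~R) y & forall n, (p %| X n - x0)%Z.
Proof.
move=> em pm px0 H0.
pose Inv k (x : int) := ~~ (p %| x)%Z /\ ((p%:Z ^+ (2 * s + 1 + k)) %| x ^+ m - u)%Z.
(* The choice of a successor has to be total; pairs that violate the invariant get 0. *)
have step (kx : nat * int) : exists x', Inv kx.1 kx.2 ->
    Inv kx.1.+1 x' /\ ((p%:Z ^+ kx.1.+1) %| x' - kx.2)%Z.
  case: kx => k x /=; have [[px Hx]|nI] := boolp.EM (Inv k x); last by exists 0.
  have [x' [H1 H2]] := hensel_step em pm px Hx; exists x' => _; split=> //; split=> //.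
  have pd : (p %| x' - x)%Z by apply: dvdz_trans H2; rewrite exprS dvdz_mulr.
  apply: contra px => px'; have -> : x = x' - (x' - x) by ring.
  exact: rpredB.
have [F HF] := boolp.choice step.
pose X := fix X n := if n is n'.+1 then F (n', X n') else x0.
have HX n : Inv n (X n).
  elim: n => [|n IH]; first by rewrite /Inv addn0.
  by have [] := HF (n, X n) IH.
have dX n : ((p%:Z ^+ n.+1) %| X n.+1 - X n)%Z by have [] := HF (n, X n) (HX n).
have [] := @root_of_approximations R K w m u%:~R (fun n => (X n)%:~R) 1 (w p%:R)
   w_complete (absv_ge0 _ _) wp.
- move=> n; rewrite mul1r -rmorphB; apply: le_trans (absv_dvd (dX n)) _.
  by rewrite ler_wiXn2l ?absv_ge0 // ltW.
- move=> n; rewrite mul1r -rmorphXn -rmorphB; have [_ H] := HX n.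
  apply: le_trans (absv_dvd H) _.
  by rewrite ler_wiXn2l ?absv_ge0 ?leq_addl // ltW.
move=> y yu Xy; exists y => //; exists X => //.
elim=> [|n IH]; first by rewrite subrr dvdz0.
have -> : X n.+1 - x0 = (X n.+1 - X n) + (X n - x0) by ring.
by apply: rpredD => //; apply: dvdz_trans (dX n); rewrite exprS dvdz_mulr.
Qed.

Lemma hensel_simple (m : nat) (x0 u : int) : ~~ (p %| m)%N -> ~~ (p %| x0)%Z ->
  (p %| x0 ^+ m - u)%Z ->
  exists2 y : K, y ^+ m = u%:~R & exists2 X : nat -> int,
    converges_to w (fun n => (X n)%:~R) y & forall n, (p %| X n - x0)%Z.
Proof. by move=> pm px H; apply: (@hensel_root m 0 m); rewrite ?mul1n. Qed.

End NonArchimedean.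
End Roots.

(** If [v] were 1 at every prime, it would be trivial on the rationals, hence bounded on the
    finite-dimensional [k]. Powers of an element and of its inverse would then stay bounded, making
    [v] trivial. *)
Lemma place_dichotomy (R : realType) (k : fieldExtType rat) (v : absolute_value R k) :
  nontrivial v -> 1 < v 2 \/ v 2 <= 1 /\ exists2 p, prime p & v p%:R < 1.
Proof.
move=> [x0 x0n vx0]; have [v2|v2] := ltP 1 (v 2); [by left|right]; split=> //.
apply: boolp.contrapT => H.
have vp p : prime p -> v p%:R = 1.
  move=> pp; apply: le_anti; rewrite absv_nat_le1 //= leNgt; apply/negP => vp1.
  by apply: H; exists p.
have vn n : (0 < n)%N -> v n%:R = 1.
  elim/ltn_ind: n => n IH n0; have [n1|n1] := leqP n 1.
    by rewrite (_ : n = 1%N) ?absv1 //; lia.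
  have pn := pdiv_prime n1; rewrite -(divnK (pdiv_dvd n)) natrM absvM [v (pdiv n)%:R]vp // mulr1.
  apply: IH; first by rewrite ltn_Pdiv // prime_gt1.
  by rewrite divn_gt0 ?prime_gt0 // dvdn_leq // pdiv_dvd.
have vz (z : int) : z != 0 -> v z%:~R = 1.
  by case: z => [[|n]|n] // _; rewrite ?NegzE ?rmorphN ?absvN; apply: vn.
have vq (c : rat) : v c%:A <= 1.
  have [->|c0] := eqVneq c 0; first by rewrite scale0r absv0.
  have -> : c%:A = ratr c :> k by rewrite -(fmorph_eq_rat (in_alg k)).
  by rewrite /ratr absvM absvV !vz ?denq_eq0 ?numq_eq0 // invr1 mulr1.
pose b := vbasis {: k}; pose B := \sum_(i < \dim {: k}) v b`_i.
have bd y : v y <= B.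
  rewrite (coord_vbasis (memvf y)); apply: le_trans (absv_sum _ _ _ _) _.
  apply: ler_sum => i _; rewrite -mulr_algl absvM ler_piMl ?absv_ge0 //.
have le1 y : v y <= 1.
  rewrite leNgt; apply/negP => vy; have [n] := expr_unbounded B vy.
  by rewrite ltNge -absvX bd.
have /negP[] := vx0; apply/eqP/le_anti; rewrite le1 /=.
by rewrite -invf_le1 ?absv_gt0 // -absvV le1.
Qed.

(** * Lines on diagonal surfaces *)

Lemma poly_fun_eq0 (k : fieldType) (p : {poly k}) :
  [pchar k] =i pred0 -> (forall t, p.[t] = 0) -> p = 0.
Proof.
move=> ch0 p0; apply: (roots_geq_poly_eq0 (rs := [seq i%:R | i <- iota 0 (size p)])).
- by apply/allP => x _; apply/rootP.
- rewrite map_inj_uniq ?iota_uniq // => i j.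
  wlog: i j / (i <= j)%N => [W|leij].
    by case/orP: (leq_total i j) => /W // + e => /(_ (esym e)).
  move/eqP; rewrite eq_sym -subr_eq0 -natrB // ((pcharf0P k).1 ch0).
  by rewrite subn_eq0 => leji; apply/eqP; rewrite eqn_leq leij.
- by rewrite size_map size_iota.
Qed.

(* Differentiate the identity in the direction (x, y). *)
Lemma polarize (k : fieldType) (n : nat) (c u w : 'I_n -> k) (e : nat) :
  [pchar k] =i pred0 ->
  (forall s t, \sum_i c i * (s * u i + t * w i) ^+ e.+1 = 0) ->
  forall x y s t,
    \sum_i c i * (x * u i + y * w i) * (s * u i + t * w i) ^+ e = 0.
Proof.
move=> ch0 H x y s t.
pose l i := s * u i + t * w i; pose m i := x * u i + y * w i.
pose P := \sum_i c i *: ((l i)%:P + m i *: 'X) ^+ e.+1.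
have P0 : P = 0.
  apply: poly_fun_eq0 => // z; rewrite -[RHS](H (s + z * x) (t + z * y)).
  rewrite /P horner_sum; apply: eq_bigr => i _.
  by rewrite hornerZ horner_exp !hornerE /l /m; congr (_ * _ ^+ _); ring.
have := congr1 (fun Q => (Q^`()).[0]) P0.
rewrite /P deriv0 horner0 (raddf_sum deriv) horner_sum.
under eq_bigr => i _.
  rewrite /= derivZ deriv_exp derivD derivC derivZ derivX !hornerE hornerMn !hornerE /=.
  rewrite ?(mulr0, addr0, add0r, mulr1) -mulr_natr.
  rewrite (_ : _ * _ = e.+1%:R * (c i * m i * l i ^+ e)); last by ring.
  over.
by rewrite -big_distrr /= => /eqP; rewrite mulf_eq0 ((pcharf0P k).1 ch0) => /eqP.
Qed.

(** * Four linear forms in two variables with a vanishing weighted sum of d-th powers *)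

Section FourPoints.
Variables (k : fieldType) (d : nat) (a u w : 'I_4 -> k).
Hypothesis ch0 : [pchar k] =i pred0.
Hypothesis a_neq0 : forall i, a i != 0.
Hypothesis d_ge4 : (4 <= d)%N.
Hypothesis vanish : forall s t, \sum_i a i * (s * u i + t * w i) ^+ d = 0.

(* The choice (x, y) = (w j, - u j) in polarize kills the j-th form, and multiplies the
   coefficient of the i-th by br i j. *)
Definition br (i j : 'I_4) := u i * w j - u j * w i.

Lemma brxx i : br i i = 0. Proof. by rewrite /br subrr. Qed.

Lemma vanish1 j s t :
  \sum_i (a i * br i j) * (s * u i + t * w i) ^+ d.-1 = 0.
Proof.
have := @polarize k 4 a u w d.-1 ch0; rewrite prednK; last by case: d d_ge4.
move=> /(_ vanish (w j) (- u j) s t) H; rewrite -[RHS]H; apply: eq_bigr => i _.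
by rewrite /br; ring.
Qed.

Lemma vanish2 j l s t :
  \sum_i (a i * br i j * br i l) * (s * u i + t * w i) ^+ d.-2 = 0.
Proof.
have := @polarize k 4 (fun i => a i * br i j) u w d.-2 ch0.
rewrite prednK; last by case: d d_ge4 => [|[|]].
move=> /(_ (vanish1 j) (w l) (- u l) s t) H; rewrite -[RHS]H; apply: eq_bigr => i _.
by rewrite /br; ring.
Qed.

Lemma vanish3 j l m s t :
  \sum_i (a i * br i j * br i l * br i m) * (s * u i + t * w i) ^+ d.-2.-1 = 0.
Proof.
have := @polarize k 4 (fun i => a i * br i j * br i l) u w d.-2.-1 ch0.
rewrite prednK; last by case: d d_ge4 => [|[|[|]]].
move=> /(_ (vanish2 j l) (w m) (- u m) s t) H; rewrite -[RHS]H; apply: eq_bigr => i _.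
by rewrite /br; ring.
Qed.

Lemma sum_perm4 (F : 'I_4 -> k) i j l m : uniq [:: i; j; l; m] ->
  \sum_x F x = F i + F j + F l + F m.
Proof.
move=> U; rewrite -[LHS]big_enum /=.
rewrite (perm_big [:: i; j; l; m]) /=; last first.
  apply: uniq_perm => //; first exact: enum_uniq.
  have sub : {subset [:: i; j; l; m] <= enum 'I_4} by move=> x _; rewrite mem_enum.
  have le : (size (enum 'I_4) <= size [:: i; j; l; m])%N by rewrite -cardE card_ord.
  by have [_ H] := uniq_min_size U sub le => x; rewrite -H.
by rewrite !big_cons big_nil addr0 !addrA.
Qed.

Lemma lin_eq0 i : (forall s t, s * u i + t * w i = 0) -> u i = 0 /\ w i = 0.
Proof.
move=> H; split; first by have := H 1 0; rewrite mul1r mul0r addr0.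
by have := H 0 1; rewrite mul1r mul0r add0r.
Qed.

Lemma cancel_lin i c e : (forall s t, c * (s * u i + t * w i) ^+ e = 0) ->
  c != 0 -> u i = 0 /\ w i = 0.
Proof.
move=> H c0; apply: lin_eq0 => s t.
have /eqP := H s t; rewrite mulf_eq0 (negPf c0) /= expf_eq0.
by case/andP => _ /eqP.
Qed.

(** A vector parallel to two independent ones is zero; the identities are Cramer's rule. *)
Lemma br_eq0 i j l : br i j != 0 -> br i l = 0 -> br j l = 0 ->
  u l = 0 /\ w l = 0.
Proof.
move=> ij il jl.
have e1 : u l * br i j = 0.
  have -> : u l * br i j = u j * br i l - u i * br j l by rewrite /br; ring.
  by rewrite il jl !mulr0 subrr.
have e2 : w l * br i j = 0.
  have -> : w l * br i j = w j * br i l - w i * br j l by rewrite /br; ring.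
  by rewrite il jl !mulr0 subrr.
by split; apply/eqP; [move/eqP: e1|move/eqP: e2]; rewrite mulf_eq0 (negPf ij) orbF.
Qed.

Lemma br_sym i j : br i j = - br j i. Proof. by rewrite /br opprB. Qed.

Lemma br_neq0_pt i j : br i j != 0 -> u i = 0 /\ w i = 0 -> False.
Proof. by move=> + [ui wi]; rewrite /br ui wi mulr0 mul0r subrr eqxx. Qed.

(** If form l vanishes, killing forms j and m by derivatives isolates form i, so forms i and m are
    parallel; in the same way j and m are. Hence form m vanishes as well, and killing form j alone
    isolates form i, which is not zero. *)
Lemma no_zero_point i j l m : uniq [:: i; j; l; m] -> br i j != 0 ->
  u l = 0 /\ w l = 0 -> False.
Proof.
move=> U ij [ul wl].
have bl x : br x l = 0 by rewrite /br ul wl !mulr0 mul0r subrr.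
have bl' x : br l x = 0 by rewrite br_sym bl oppr0.
have lz s t e : (0 < e)%N -> (s * u l + t * w l) ^+ e = 0.
  by rewrite ul wl !mulr0 addr0 expr0n; case: e.
have ji : br j i != 0 by rewrite br_sym oppr_eq0.
have im : br i m = 0.
  apply/eqP/negPn/negP => im; apply: (br_neq0_pt ij).
  apply: (@cancel_lin i (a i * br i j * br i m) d.-2); last first.
    by rewrite !mulf_neq0.
  move=> s t; rewrite -[RHS](vanish2 j m s t) (sum_perm4 _ U) !brxx bl'.
  by rewrite !(mulr0, mul0r, addr0).
have jm : br j m = 0.
  apply/eqP/negPn/negP => jm; apply: (br_neq0_pt ji).
  apply: (@cancel_lin j (a j * br j i * br j m) d.-2); last first.
    by rewrite !mulf_neq0.
  move=> s t; rewrite -[RHS](vanish2 i m s t) (sum_perm4 _ U) !brxx bl'.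
  by rewrite !(mulr0, mul0r, addr0, add0r).
have [um wm] := br_eq0 ij im jm.
apply: (br_neq0_pt ij).
apply: (@cancel_lin i (a i * br i j) d.-1); last by rewrite mulf_neq0.
move=> s t; rewrite -[RHS](vanish1 j s t) (sum_perm4 _ U) !brxx bl'.
have -> : br m j = 0 by rewrite /br um wm !mulr0 mul0r subrr.
by rewrite !(mulr0, mul0r, addr0).
Qed.

Lemma br_prop i j l : br i j != 0 -> br i l = 0 ->
  exists lam, u l = lam * u i /\ w l = lam * w i.
Proof.
move=> ij il; exists (br l j / br i j).
have e1 : u l * br i j = br l j * u i.
  have -> : u l * br i j = br l j * u i + u j * br i l by rewrite /br; ring.
  by rewrite il mulr0 addr0.
have e2 : w l * br i j = br l j * w i.
  have -> : w l * br i j = br l j * w i + w j * br i l by rewrite /br; ring.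
  by rewrite il mulr0 addr0.
by split; apply: (mulIf ij); rewrite ?e1 ?e2; field.
Qed.

(** Killing form j also kills its multiple, form m. What remains is a power of form i, whose
    coefficient is [a i + a l * lam ^+ d] times [br i j]. *)
Lemma pairing_coef i j l m : uniq [:: i; j; l; m] -> br i j != 0 ->
  br i l = 0 -> br j m = 0 -> exists lam, a i + a l * lam ^+ d = 0.
Proof.
move=> U ij il jm; have [lam [ul wl]] := br_prop ij il.
exists lam.
apply/eqP/negPn/negP => nz; apply: (br_neq0_pt ij).
apply: (@cancel_lin i ((a i + a l * lam ^+ d) * br i j) d.-1); last first.
  by rewrite mulf_neq0.
move=> s t; rewrite -[RHS](vanish1 j s t) (sum_perm4 _ U) brxx.
rewrite (br_sym m) jm oppr0 !(mulr0, mul0r, addr0).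
have -> : br l j = lam * br i j by rewrite /br ul wl; ring.
have -> : s * u l + t * w l = lam * (s * u i + t * w i) by rewrite ul wl; ring.
rewrite exprMn; have -> : lam ^+ d = lam * lam ^+ d.-1.
  by rewrite -exprS prednK //; case: d d_ge4.
by ring.
Qed.

(** A third derivative kills forms j, l and m, so form i must be parallel to l or to m; likewise
    form j. They cannot be parallel to the same one, which would then vanish. *)
Lemma four_points i j l m : uniq [:: i; j; l; m] -> br i j != 0 ->
  (exists lam mu, a i + a l * lam ^+ d = 0 /\ a j + a m * mu ^+ d = 0) \/
  (exists lam mu, a i + a m * lam ^+ d = 0 /\ a j + a l * mu ^+ d = 0).
Proof.
move=> U ij.
have ji : br j i != 0 by rewrite br_sym oppr_eq0.
have Uji : uniq [:: j; i; m; l].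
  move: U; rewrite /= !inE !negb_or (eq_sym j i) (eq_sym m l).
  by case/and4P=> /and3P[-> -> ->] /andP[-> ->] -> _.
have Uijml : uniq [:: i; j; m; l].
  move: U; rewrite /= !inE !negb_or (eq_sym m l).
  by case/and4P=> /and3P[-> -> ->] /andP[-> ->] -> _.
have Ujilm : uniq [:: j; i; l; m].
  move: U; rewrite /= !inE !negb_or (eq_sym j i).
  by case/and4P=> /and3P[-> -> ->] /andP[-> ->] -> _.
have ilm : br i l * br i m = 0.
  apply/eqP/negPn/negP => ilm; apply: (br_neq0_pt ij).
  apply: (@cancel_lin i (a i * br i j * br i l * br i m) d.-2.-1); last first.
    by rewrite -mulrA mulf_neq0 // mulf_neq0.
  move=> s t; rewrite -[RHS](vanish3 j l m s t) (sum_perm4 _ U) !brxx.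
  by rewrite !(mulr0, mul0r, addr0).
have jlm : br j l * br j m = 0.
  apply/eqP/negPn/negP => jlm; apply: (br_neq0_pt ji).
  apply: (@cancel_lin j (a j * br j i * br j l * br j m) d.-2.-1); last first.
    by rewrite -mulrA mulf_neq0 // mulf_neq0.
  move=> s t; rewrite -[RHS](vanish3 i l m s t) (sum_perm4 _ U) !brxx.
  by rewrite !(mulr0, mul0r, addr0, add0r).
move/eqP: ilm; move/eqP: jlm; rewrite !mulf_eq0.
case/orP=> /eqP j0 /orP[] /eqP i0.
- by case: (no_zero_point U ij (br_eq0 ij i0 j0)).
- right; have [lam H1] := pairing_coef Uijml ij i0 j0.
  have [mu H2] := pairing_coef Ujilm ji j0 i0.
  by exists lam, mu.
- left; have [lam H1] := pairing_coef U ij i0 j0.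
  have [mu H2] := pairing_coef Uji ji j0 i0.
  by exists lam, mu.
- by case: (no_zero_point Uijml ij (br_eq0 ij i0 j0)).
Qed.

End FourPoints.

Lemma rank2_minor (k : fieldType) (n : nat) (L : 'M[k]_(2, n)) : \rank L = 2%N ->
  exists i j, L 0 i * L 1 j - L 0 j * L 1 i != 0.
Proof.
move=> rL; have fL : row_free L by rewrite /row_free rL.
have inj (x y : k) : (forall j, x * L 0 j + y * L 1 j = 0) -> x = 0 /\ y = 0.
  move=> H; pose z : 'rV[k]_2 := \row_j (if j == 0 then x else y).
  have /(row_free_inj fL) z0 : z *m L = 0 *m L.
    rewrite mul0mx; apply/rowP => j; rewrite !mxE big_ord_recl big_ord1 !mxE /=.
    by rewrite -[RHS](H j); congr (_ + _ * L _ _); apply/val_inj.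
  split; first by have /rowP/(_ 0) := z0; rewrite !mxE.
  by have /rowP/(_ 1) := z0; rewrite !mxE.
have [i Li] : exists i, L 0 i != 0.
  apply/existsP; apply: contraT => /existsPn H.
  have [] := inj 1 0; last by move=> /eqP; rewrite oner_eq0.
  by move=> j; rewrite mul0r mul1r addr0; apply/eqP/negPn.
exists i; apply/existsP; apply: contraT => /existsPn H.
have [] := inj (- L 1 i) (L 0 i); last by move=> _ Li0; rewrite Li0 eqxx in Li.
move=> j; apply/eqP; have := H j; rewrite negbK => /eqP <-.
by apply/eqP; ring.
Qed.

(** On the line the coordinates are linear forms in two parameters, and a nonzero 2 x 2 minor
    supplies two independent ones. *)
Lemma line_pairing (k : fieldType) (d : nat) (S : diagonal_surface k d) :
  [pchar k] =i pred0 -> (4 <= d)%N -> contains_line_over (@idfun k) S ->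
  exists i j l m : 'I_4, uniq [:: i; j; l; m] /\
    exists lam mu, S i + S l * lam ^+ d = 0 /\ S j + S m * mu ^+ d = 0.
Proof.
move=> ch0 d4 [L rL HL].
have vanish s t : \sum_i S i * (s * L 0 i + t * L 1 i) ^+ d = 0.
  pose z : 'rV[k]_2 := \row_j (if j == 0 then s else t).
  have zL : (z *m L <= map_mx idfun L)%MS.
    have -> : map_mx idfun L = L by apply/matrixP => i j; rewrite mxE.
    exact: submxMl.
  have := HL k idfun (z *m L) zL; rewrite /on_surface => H.
  rewrite -[RHS]H; apply: eq_bigr => i _ /=; congr (_ * _ ^+ _).
  rewrite !mxE big_ord_recl big_ord1 !mxE /=.
  by congr (_ + _ * L _ _); apply/val_inj.
have [i [j ij]] := rank2_minor rL.
have nij : i != j by apply: contraNneq ij => ->; rewrite subrr.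
have [l [m U]] : exists l m, uniq [:: i; j; l; m].
  pose A := ~: [set i; j].
  have cA : #|A| = 2%N by rewrite cardsCs setCK cards2 nij card_ord.
  have /cards2P [l [m [lm eA]]] : #|A| == 2%N by rewrite cA.
  have : l \in A by rewrite eA !inE eqxx.
  have : m \in A by rewrite eA !inE eqxx orbT.
  rewrite !inE !negb_or => /andP[mi mj] /andP[li lj].
  exists l, m; rewrite /= !inE !negb_or nij lm andbT.
  by rewrite (eq_sym i l) (eq_sym i m) (eq_sym j l) (eq_sym j m) li mi lj mj.
have [[lam [mu H]]|[lam [mu H]]] :=
  @four_points k d S (L 0) (L 1) ch0 (@dcoef_neq0 _ _ S) d4 vanish i j l m U ij.
  by exists i, j, l, m; split => //; exists lam, mu.
exists i, j, m, l; split; last by exists lam, mu.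
move: U; rewrite /= !inE !negb_or (eq_sym m l).
by case/and4P=> /and3P[-> -> ->] /andP[-> ->] -> _.
Qed.

(** The line is spanned by e_i + lam e_l and e_j + mu e_m; on it the four terms cancel in pairs. *)
Lemma line_of_pairing (k K : fieldType) (f : {rmorphism k -> K}) (d : nat)
    (S : diagonal_surface k d) (i j l m : 'I_4) (lam mu : K) :
  uniq [:: i; j; l; m] -> f (S i) + f (S l) * lam ^+ d = 0 ->
  f (S j) + f (S m) * mu ^+ d = 0 -> contains_line_over f S.
Proof.
move=> U H1 H2.
have := U; rewrite /= !inE !negb_or => /and4P[/and3P[ij il im] /andP[jl jm] lm _].
pose L : 'M[K]_(2, 4) := \matrix_(r, x)
  (if r == 0 then (if x == i then 1 else if x == l then lam else 0)
   else (if x == j then 1 else if x == m then mu else 0)).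
exists L.
  apply/eqP; change (row_free L); apply/row_freeP.
  exists (\matrix_(x, r) (if r == 0 then (x == i)%:R else (x == j)%:R)).
  apply/matrixP => r r'; rewrite !mxE (sum_perm4 _ U) !mxE.
  have [ji li mi] : [/\ j != i, l != i & m != i] by rewrite !(eq_sym _ i).
  have [lj mj ml] : [/\ l != j, m != j & m != l] by rewrite !(eq_sym _ j) (eq_sym m).
  rewrite !eqxx ?(negPf ij) ?(negPf il) ?(negPf im) ?(negPf jl) ?(negPf jm) ?(negPf lm).
  rewrite ?(negPf ji) ?(negPf li) ?(negPf mi) ?(negPf lj) ?(negPf mj) ?(negPf ml).
  by case: r => [[|[|//]] p]; case: r' => [[|[|//]] p'];
    rewrite /= !(mulr0, mulr1, mul0r, mul1r, addr0, add0r).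
move=> E g x /submxP[z ->]; rewrite /on_surface.
pose s := z 0 0; pose t := z 0 1.
have Ex y : (z *m map_mx g L) 0 y = s * g (L 0 y) + t * g (L 1 y).
  rewrite mxE big_ord_recl big_ord1 !mxE /=.
  by congr (_ + z 0 _ * _); apply/val_inj.
have [ji li mi] : [/\ j != i, l != i & m != i] by rewrite !(eq_sym _ i).
have [lj mj ml] : [/\ l != j, m != j & m != l] by rewrite !(eq_sym _ j) (eq_sym m).
rewrite (sum_perm4 _ U) !Ex !mxE /= !eqxx.
rewrite ?(negPf ij) ?(negPf il) ?(negPf im) ?(negPf jl) ?(negPf jm) ?(negPf lm).
rewrite ?(negPf ji) ?(negPf li) ?(negPf mi) ?(negPf lj) ?(negPf mj) ?(negPf ml).
rewrite !rmorph0 !rmorph1 !(mulr0, mulr1, addr0, add0r) !exprMn.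
have := congr1 (fun y => s ^+ d * g y) H1; have := congr1 (fun y => t ^+ d * g y) H2.
rewrite !rmorphD !rmorphM !rmorphXn !rmorph0 !mulr0 => G2 G1.
by rewrite -[RHS]addr0 -{1}G1 -[in RHS]G2; ring.
Qed.

(** The partner of index 0 decides which of [a], [c], [- (c / a)] must be a d-th power. Conversely,
    for [a] the second pair has the same ratio, and for [c] its ratio differs by the d-th power
    [a ^+ 2]. *)
Lemma fails_Hasse_principle_criterion (R : realType) (k : fieldType) (d : nat) (a g c : k) :
  [pchar k] =i pred0 -> (4 <= d)%N -> a != 0 -> c != 0 -> a ^+ 2 = g ^+ d ->
  ~ (exists x, a = x ^+ d) -> ~ (exists x, c = x ^+ d) ->
  ~ (exists x, - (c / a) = x ^+ d) ->
  (forall v : absolute_value R k, nontrivial v -> forall kv : completion v,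
    (exists y, compl_emb kv a = y ^+ d) \/ (exists y, compl_emb kv c = y ^+ d)) ->
  exists S : diagonal_surface k d, fails_Hasse_principle_for_lines R S.
Proof.
move=> ch0 d4 a0 c0 ag aN cN caN loc.
have dN0 : (d == 0)%N = false by apply/negbTE; rewrite -lt0n (leq_trans _ d4).
pose co (i : 'I_4) := nth 0 [:: 1; c / a; - a; - c] i.
have co0 i : co i != 0.
  rewrite /co; case: i => [[|[|[|[|//]]]] p] /=;
  by rewrite ?oner_eq0 ?oppr_eq0 ?mulf_neq0 ?invr_neq0.
exists (DiagonalSurface d co0); split.
  move=> v vn kv.
  pose o (n : nat) (p : (n < 4)%N) : 'I_4 := Ordinal p.
  pose f := compl_emb kv.
  have fa0 : f a != 0 by rewrite fmorph_eq0.
  have [[y fy]|[y fy]] := loc v vn kv.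
    apply: (@line_of_pairing _ _ _ _ _ (@o 2 isT) (@o 3 isT) (@o 0 isT) (@o 1 isT) y y) => //=.
      by rewrite -fy rmorph1 mul1r rmorphN addNr.
    by rewrite -fy rmorphN fmorph_div -/f; field.
  have g0 : g != 0.
    apply: contra_neq a0 => g0; apply/eqP; rewrite -sqrf_eq0 ag g0 expr0n.
    by rewrite dN0.
  apply: (@line_of_pairing _ _ _ _ _ (@o 3 isT) (@o 1 isT) (@o 0 isT) (@o 2 isT) y (y / f g)) => //=.
    by rewrite -fy rmorph1 mul1r rmorphN addNr.
  rewrite expr_div_n -fy -rmorphXn -ag rmorphXn rmorphN fmorph_div -/f.
  by field.
move=> /(line_pairing ch0 d4) [i [j [l [m [U [lam [mu [/= H1 H2]]]]]]]].
have rsym (x y z : k) : x != 0 -> x + y * z ^+ d = 0 -> y + x * z^-1 ^+ d = 0.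
  move=> x0 E.
  have zd : z ^+ d != 0.
    by apply: contra_neq x0 => zd; move: E; rewrite zd mulr0 addr0.
  have -> : x = - (y * z ^+ d) by apply/eqP; rewrite -subr_eq0 opprK E.
  by rewrite exprVn; field.
(* Only the pair containing index 0 is examined; [rsym] turns it round if 0 comes second. *)
have [x [x0 [z Hz]]] : exists x, x != 0 /\ exists z, 1 + co x * z ^+ d = 0.
  have : 0 \in [:: i; j; l; m].
    have sub : {subset [:: i; j; l; m] <= enum 'I_4} by move=> x _; rewrite mem_enum.
    have le : (size (enum 'I_4) <= size [:: i; j; l; m])%N by rewrite -cardE card_ord.
    by have [_ ->] := uniq_min_size U sub le; rewrite mem_enum.
  move: U; rewrite /= !inE !negb_or => /and4P[/and3P[ij il im] /andP[jl jm] lm _].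
  case/or4P=> /eqP e0; subst.
  - by exists l; rewrite eq_sym; split=> //; exists lam.
  - by exists m; rewrite eq_sym; split=> //; exists mu.
  - exists i; split=> //; exists lam^-1; exact: (rsym _ 1).
  - exists j; split=> //; exists mu^-1; exact: (rsym _ 1).
have zd : z ^+ d != 0.
  apply: contra_eq_neq Hz => ->; by rewrite mulr0 addr0 oner_neq0.
have E1 : - co x = z^-1 ^+ d.
  rewrite exprVn; apply: (mulIf zd); rewrite mulVf // mulNr.
  by apply/eqP; rewrite eq_sym -addr_eq0 Hz.
case: x x0 Hz E1 => [[|[|[|[|//]]]] p] //= _ _ E1.
- by apply: caN; exists z^-1.
- by apply: aN; exists z^-1; rewrite -E1 opprK.
- by apply: cN; exists z^-1; rewrite -E1 opprK.
Qed.

(** * Real embeddings *)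

(** The primitive element theorem. The polynomials are rational so that they can also be evaluated
    at the complex roots of [p], which gives the embeddings of [k]. *)
Lemma number_field_primitive (k : fieldExtType rat) :
  exists (t : k) (p : {poly rat}) (P : k -> {poly rat}),
  [/\ separable_poly p, (1 < size p)%N,
      forall x, (map_poly (in_alg k) (P x)).[t] = x,
      forall x, (size (P x) < size p)%N &
      forall A, (map_poly (in_alg k) A).[t] = 0 -> p %| A].
Proof.
have ch0 : [pchar k] =i pred0.
  by move=> i; rewrite (pchar_lalg k) pchar_num.
have sep : separable 1%AS {:k}%AS.
  by apply/separableP => u _; apply: pcharf0_separable.
pose t := separable_generator 1%AS {:k}%AS.
have full : <<1; t>>%VS = fullv.
  by have := eq_adjoin_separable_generator sep (sub1v _).
have [p ep] := polyOver1P (minPolyOver 1%AS t).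
have PH (x : k) : exists q : {poly rat}, Fadjoin_poly 1%AS t x = map_poly (in_alg k) q.
  by have [q] := polyOver1P (Fadjoin_polyOver 1%AS t x); exists q.
exists t, p.
have PH' x : {q : {poly rat} | Fadjoin_poly 1%AS t x == map_poly (in_alg k) q}.
  by apply: sigW; have [q ->] := PH x; exists q.
have sp : size p = (adjoin_degree 1%AS t).+1.
  by rewrite -size_minPoly ep size_map_poly.
exists (fun x => sval (PH' x)); split.
- by have := pcharf0_separable 1%AS ch0 t; rewrite /separable_element ep separable_map.
- by rewrite sp ltnS adjoin_degreeE divn_gt0 ?dimv1 ?adim_gt0.
- move=> x; have /eqP <- := svalP (PH' x).
  by rewrite Fadjoin_poly_eq // full memvf.
- move=> x; have /eqP e := svalP (PH' x).
  by rewrite -(size_map_poly (in_alg k)) -e sp ltnS size_Fadjoin_poly.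
- move=> A At; rewrite -(dvdp_map (in_alg k)) -ep; apply: minPoly_dvdp; last exact/rootP.
  by apply/polyOver1P; exists A.
Qed.

(** Each complex root of [p] gives an embedding, real by hypothesis. If all of them send [w] to
    [rho], then [P w] minus [rho] has as many distinct roots as the degree of [p], but smaller
    degree. So it is zero, and [P w] is constant. *)
Lemma real_embeddings (R : realType) (k : fieldExtType rat) : totally_real R k ->
  exists (D : nat) (r : 'I_D -> {rmorphism k -> R}), (0 < D)%N /\
    forall w rho, (forall i, r i w = rho) -> exists c : rat, w = c%:A.
Proof.
move=> hk; have [t [p [P [sep p1 Pt Ps pdvd]]]] := number_field_primitive k.
pose C := (R[i])%C.
pose pC : {poly C} := map_poly ratr p.
have [zs ezs] := closed_field_poly_normal pC.
have p0 : p != 0 by apply: contraTneq p1 => ->; rewrite size_poly0.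
have pC0 : pC != 0 by rewrite map_poly_eq0.
have szs : size zs = (size p).-1.
  have := congr1 (fun q : {poly C} => size q) ezs.
  rewrite size_scale ?lead_coef_eq0 // size_prod_XsubC size_map_poly => ->.
  by [].
have uzs : uniq zs.
  have : separable_poly pC by rewrite separable_map.
  rewrite ezs -mul_polyC separable_mul => /and3P[_ + _].
  by rewrite separable_prod_XsubC.
have rzs z : z \in zs -> root pC z.
  by move=> zin; rewrite ezs rootZ ?lead_coef_eq0 // root_prod_XsubC.
pose ev (z : C) (A : {poly rat}) := (map_poly ratr A : {poly C}).[z].
have evP (z : C) A B : z \in zs ->
    (map_poly (in_alg k) A).[t] = (map_poly (in_alg k) B).[t] -> ev z A = ev z B.
  move=> zin AB; have : p %| A - B by apply: pdvd; rewrite rmorphB !hornerE AB subrr.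
  case/dvdpP => q /eqP; rewrite subr_eq => /eqP ->; rewrite /ev rmorphD rmorphM !hornerE.
  by have /rootP -> := rzs z zin; rewrite mulr0 add0r.
pose f (z : C) (x : k) := ev z (P x).
have fa z : z \in zs -> zmod_morphism (f z).
  move=> zin x y; rewrite /f (@evP z _ (P x - P y)) //.
    by rewrite /ev rmorphB !hornerE.
  by rewrite rmorphB !hornerE !Pt.
have fm z : z \in zs -> monoid_morphism (f z).
  move=> zin; split.
    by rewrite /f (@evP z _ 1) // ?rmorph1 ?hornerE ?Pt // /ev rmorph1 hornerE.
  move=> x y; rewrite /f (@evP z _ (P x * P y)) //.
    by rewrite /ev rmorphM !hornerE.
  by rewrite rmorphM !hornerE !Pt.
have emb z : z \in zs -> exists s : {rmorphism k -> C}, forall x, s x = f z x.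
  move=> zin.
  pose faM := GRing.isZmodMorphism.Build k C (f z) (fa z zin).
  pose fmM := GRing.isMonoidMorphism.Build k C (f z) (fm z zin).
  pose s : {rmorphism k -> C} := HB.pack (f z) faM fmM.
  by exists s.
have remb z : z \in zs -> exists s : {rmorphism k -> R}, forall x, (s x)%:C%C = f z x.
  move=> zin; have [s es] := emb z zin.
  have e x : ((complex.Re (s x))%:C)%C = s x.
    by have := hk s x; case: (s x) => a b /= ->.
  pose g x := complex.Re (s x).
  have ga : zmod_morphism g by move=> x y; rewrite /g rmorphB raddfB.
  have gm : monoid_morphism g.
    split; first by rewrite /g rmorph1.
    by move=> x y; apply: (fmorph_inj (real_complex R)); rewrite rmorphM /= !e rmorphM.
  pose gaM := GRing.isZmodMorphism.Build k R g ga.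
  pose gmM := GRing.isMonoidMorphism.Build k R g gm.
  pose h : {rmorphism k -> R} := HB.pack g gaM gmM.
  by exists h => x; rewrite -es -e.
have rembi (i : 'I_(size zs)) : exists s : {rmorphism k -> R}, forall x, (s x)%:C%C = f (tnth (in_tuple zs) i) x.
  by apply: remb; rewrite mem_tnth.
have [r Hr] := boolp.choice rembi.
exists (size zs), r; split; first by rewrite szs -subn1 subn_gt0.
move=> w rho Hw.
have : map_poly ratr (P w) - (rho%:C)%C%:P = 0 :> {poly C}.
  apply: (roots_geq_poly_eq0 (rs := zs)) => //.
    apply/allP => z zin; apply/rootP; rewrite !hornerE.
    have [i iz] := tnthP (in_tuple zs) z zin.
    have := Hr i w; rewrite Hw -iz /f /ev => <-; by rewrite subrr.
  apply: leq_trans (size_polyD _ _) _; rewrite size_polyN geq_max szs.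
  have p1' : (0 < (size p).-1)%N by rewrite -subn1 subn_gt0.
  rewrite (leq_trans (size_polyC_leq1 _)) // andbT size_map_poly.
  by have := Ps w; case: (size p) p1.
move/eqP; rewrite subr_eq0 => /eqP e.
have : (size (P w) <= 1)%N.
  by have := congr1 (fun q : {poly C} => size q) e; rewrite size_map_poly => ->; rewrite size_polyC_leq1.
move/size1_polyC => eP; exists (P w)`_0.
by rewrite -{1}(Pt w) eP map_polyC hornerC coefC.
Qed.

(** * The quadratic subextension of a cyclotomic extension *)

Lemma prime_unity_prim_root (E : fieldType) (q : nat) (z : E) :
  prime q -> z ^+ q = 1 -> z != 1 -> q.-primitive_root z.
Proof.
move=> qp zq z1; have [m zm] := prim_order_exists (prime_gt0 qp) zq.
move=> mq; have /primeP[_ /(_ m mq)/pred2P[] em] := qp; last by rewrite -em.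
by have := prim_expr_order zm; rewrite em expr1 => e; rewrite e eqxx in z1.
Qed.

(* The gcd of A^2 - delta and X^q - 1 has the root z in C, so it is not constant, and it
   splits over E. *)
Lemma square_transfer (k C E : fieldType) (i : {rmorphism k -> C}) (f : {rmorphism k -> E})
    (q : nat) (z : C) (e : E) (A : {poly k}) (delta : k) :
  prime q -> z ^+ q = 1 -> e ^+ q = 1 -> e != 1 ->
  (map_poly i A).[z] ^+ 2 = i delta -> exists y, f delta = y ^+ 2.
Proof.
move=> qp zq eq1 e1 Az; have ep := prime_unity_prim_root qp eq1 e1.
pose X1 : {poly k} := 'X^q - 1; pose B := A ^+ 2 - delta%:P.
pose G := gcdp B X1.
have mX1 (L : fieldType) (g : {rmorphism k -> L}) : map_poly g X1 = 'X^q - 1.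
  by rewrite rmorphB rmorph1 /= map_polyXn.
have Gz : root (map_poly i G) z.
  rewrite gcdp_map root_gcd; apply/andP; split; apply/rootP.
    by rewrite rmorphB rmorphXn /= map_polyC !hornerE Az subrr.
  by rewrite mX1 !hornerE zq subrr.
have X10 : X1 != 0.
  by rewrite -size_poly_eq0 size_XnsubC ?prime_gt0.
have G0 : G != 0 by rewrite gcdp_eq0 negb_and X10 orbT.
have sG : (1 < size G)%N.
  rewrite -(size_map_poly i); apply: (root_size_gt1 _ Gz).
  by rewrite map_poly_eq0.
have : map_poly f G %| \prod_(0 <= j < q) ('X - (e ^+ j)%:P).
  by rewrite factor_Xn_sub_1 // -(mX1 _ f) dvdp_map dvdp_gcdr.
case/dvdp_prod_XsubC => m Gm.
have [y Gy] : exists y, root (map_poly f G) y.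
  case em : (mask m (index_iota 0 q)) => [|j s].
    have := eqp_size Gm; rewrite em big_nil size_polyC oner_eq0 size_map_poly => sG1.
    by rewrite sG1 in sG.
  exists (e ^+ j); rewrite (eqp_root Gm) em big_cons rootM root_XsubC eqxx //.
exists (map_poly f A).[y]; move: Gy; rewrite gcdp_map root_gcd => /andP[/rootP + _].
rewrite rmorphB rmorphXn /= map_polyC !hornerE => /eqP; rewrite subr_eq0 => /eqP ->.
by [].
Qed.

(** * Descent through subgroups of 2-power index, when squares of the extension lying in the base
    are squares there *)

Section Descent.
Variables (k C : fieldType) (i : {rmorphism k -> C}) (q : nat) (z : C) (g : nat).
Hypothesis q_prime : prime q.
Hypothesis char_k : [pchar k] =i pred0.
Hypothesis z_prim : q.-primitive_root z.
Hypothesis g_gen : forall b, ~~ (q %| b)%N -> exists j, (b = g ^ j %[mod q])%N.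
Hypothesis squares : forall (delta : k) (A : {poly k}),
  (map_poly i A).[z] ^+ 2 = i delta -> exists x, delta = x ^+ 2.

Local Notation ev T y := ((map_poly i T).[y]).

(** Orthogonality: only the coefficients of [T] at multiples of q survive, each with factor q. *)
Lemma sum_unity_powers (T : {poly k}) :
  exists c, \sum_(b < q) ev T (z ^+ b) = i c.
Proof.
exists (\sum_(j < size T) T`_j * (if (q %| j)%N then q%:R else 0)).
rewrite rmorph_sum /=.
transitivity (\sum_(j < size T) \sum_(b < q) i T`_j * (z ^+ j) ^+ b).
  rewrite exchange_big; apply: eq_bigr => b _; rewrite horner_poly.
  by apply: eq_bigr => j _; rewrite -!exprM mulnC.
apply: eq_bigr => j _; rewrite -mulr_sumr rmorphM /=; congr (_ * _).
case: ifP => qj.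
  have -> : z ^+ j = 1 by apply/eqP; rewrite -(prim_order_dvd z_prim).
  rewrite (eq_bigr (fun=> 1)) => [|b _]; last by rewrite expr1n.
  by rewrite sumr_const card_ord rmorph_nat.
have zj : z ^+ j - 1 != 0 by rewrite subr_eq0 -(prim_order_dvd z_prim) qj.
apply: (mulfI zj); rewrite -subrX1 rmorph0 mulr0 -exprM mulnC exprM.
by rewrite (prim_expr_order z_prim) expr1n subrr.
Qed.

(* T z is fixed by the subgroup of index dividing 2^j generated by the automorphism
   z |-> z^(g^(2^j)).  The induction splits T into the part fixed by the next larger
   subgroup and a part whose square is fixed by it. *)
Lemma fixed_in_base (j : nat) (T : {poly k}) :
  (forall b, ev T (z ^+ (b * g ^ (2 ^ j))) = ev T (z ^+ b)) ->
  exists c, ev T z = i c.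
Proof.
have q0 : ((q.-1)%:R : C) != 0.
  rewrite -(rmorph_nat i) fmorph_eq0 ((pcharf0P k).1 char_k) -lt0n -subn1 subn_gt0.
  by rewrite prime_gt1.
have two0 : (2 : C) != 0.
  by rewrite -(rmorph_nat i 2) fmorph_eq0 ((pcharf0P k).1 char_k).
elim: j T => [|j IH] T HT.
  (* At level 0 the values of [T] at z^b agree for all b prime to q, so the sum over all b, minus
     the value at 1, is q - 1 times the value at z. *)
  have HT1 n : ev T (z ^+ (g ^ n)) = ev T z.
    elim: n => [|n IHn]; first by rewrite expn0 expr1.
    by rewrite expnSr -[X in (_ * X)%N]expn1 -[1%N]/(2 ^ 0)%N HT.
  have HT2 b : ~~ (q %| b)%N -> ev T (z ^+ b) = ev T z.
    move=> /g_gen[n bn]; rewrite -(HT1 n); congr horner.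
    by apply/eqP; rewrite (eq_prim_root_expr z_prim) bn.
  have [c ec] := sum_unity_powers T.
  exists ((c - T.[1]) / (q.-1)%:R).
  have [q' eq] : exists q', q = q'.+1 by exists q.-1; rewrite prednK ?prime_gt0.
  move: ec; rewrite eq big_ord_recl /= expr0.
  rewrite (eq_bigr (fun _ => ev T z)); last first.
    move=> b _; apply: HT2; rewrite eq gtnNdvd // /bump /= add1n.
    by rewrite ltnS.
  rewrite sumr_const card_ord -[in X in X + _](rmorph1 i) horner_map => e.
  have q0' : (q'%:R : C) != 0 by rewrite eq in q0.
  apply: (mulIf q0'); rewrite fmorph_div rmorphB rmorph_nat divfK // -e.
  by rewrite addrAC subrr add0r mulr_natr.
pose h := (g ^ (2 ^ j))%N.
have hh : (g ^ (2 ^ j.+1) = h * h)%N by rewrite expnS mulnC expnM -mulnn.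
(* On powers of z, replacing z by z^h exchanges the values of [T] and [Tg], because h^2 fixes those
   of [T]. So the sum and the squared difference are fixed by h. *)
pose Tg := T \Po 'X^h.
have evTg y : ev Tg y = ev T (y ^+ h).
  by rewrite map_comp_poly horner_comp map_polyXn hornerXn.
have [c1 e1] : exists c, ev (T + Tg) z = i c.
  apply: IH => b; rewrite !rmorphD !hornerD !evTg -!exprM -/h -mulnA -hh HT.
  by rewrite addrC.
have [c2 e2] : exists c, ev ((T - Tg) ^+ 2) z = i c.
  apply: IH => b; rewrite !rmorphXn !rmorphB !horner_exp !hornerD !hornerN !evTg -!exprM -/h -mulnA -hh HT.
  by rewrite -sqrrN opprB.
have [x ex] : exists x, c2 = x ^+ 2.
  by apply: (squares (A := T - Tg)); rewrite -e2 rmorphXn horner_exp.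
have [c3 e3] : exists c, ev (T - Tg) z = i c.
  move: e2; rewrite ex !rmorphXn horner_exp => /eqP; rewrite eqf_sqr.
  by case/orP=> /eqP ->; [exists x|exists (- x); rewrite rmorphN].
exists ((c1 + c3) / 2); apply: (mulIf two0).
rewrite fmorph_div rmorphD -e1 -e3 rmorph_nat divfK // !rmorphD !rmorphN !hornerD hornerN.
by ring.
Qed.

End Descent.

Lemma prim_root_closed (C : closedFieldType) (q : nat) : [pchar C] =i pred0 -> prime q ->
  exists z : C, q.-primitive_root z.
Proof.
move=> ch0 qp; pose P : {poly C} := \poly_(j < q) 1.
have sP : size P = q.
  by apply: size_poly_eq; rewrite oner_neq0.
have /closed_rootP[z /rootP Pz] : size P != 1%N by rewrite sP gtn_eqF // prime_gt1.
have Sz : \sum_(j < q) z ^+ j = 0.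
  by rewrite -[RHS]Pz horner_poly; apply: eq_bigr => j _; rewrite mul1r.
exists z; apply: prime_unity_prim_root => //.
  by apply/eqP; rewrite -subr_eq0 subrX1 Sz mulr0.
apply/eqP => z1; move/eqP: Sz; rewrite z1 (eq_bigr (fun=> 1)) => [|j _]; last by rewrite expr1n.
by rewrite sumr_const card_ord ((pcharf0P C).1 ch0) eqn0Ngt prime_gt0.
Qed.

Lemma conjc_unity_root (R : realType) (q : nat) (z : R[i]%C) : (0 < q)%N ->
  z ^+ q = 1 -> conjc z = z^-1.
Proof.
move=> q0 zq; have z0 : z != 0.
  by apply: contra_eq_neq zq => ->; rewrite expr0n eqn0Ngt q0 eq_sym oner_neq0.
pose r := complex.Re z ^+ 2 + complex.Im z ^+ 2.
have er : z * conjc z = (r%:C)%C.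
  rewrite /r; case: z {zq z0 r} => a b /=; apply/eqP; rewrite eq_complex /=.
  by apply/andP; split; apply/eqP; ring.
have rq : r ^+ q = 1.
  apply: (fmorph_inj (real_complex R)); rewrite rmorphXn rmorph1 /= -er exprMn -rmorphXn.
  by rewrite zq rmorph1 mulr1.
have r1 : r = 1.
  by apply/eqP; rewrite -(pexpr_eq1 q0) ?rq // addr_ge0 ?sqr_ge0.
by apply: (mulfI z0); rewrite er r1 mulfV.
Qed.

(** If there were none, [square_transfer] would supply the hypothesis of the descent, which would
    put the value of [beta] at z into [k], hence into the reals. But conjugation negates each of its
    odd number of factors, so it would be 0, which is impossible for odd q. *)
Lemma quadratic_subcyclotomic (R : realType) (k : fieldType) (phi : {rmorphism k -> R})
    (q : nat) : prime q -> odd q ->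
  exists delta : k, (~ exists x, delta = x ^+ 2) /\
    forall (E : fieldType) (f : {rmorphism k -> E}) (z : E),
      z ^+ q = 1 -> z != 1 -> exists y, f delta = y ^+ 2.
Proof.
move=> qp qo; apply: boolp.contrapT => H.
have chk : [pchar k] =i pred0.
  by move=> n; rewrite -(fmorph_pchar phi) pchar_num.
have q0 := prime_gt0 qp.
pose C := (R[i])%C; pose i : {rmorphism k -> C} := (real_complex R \o phi).
have [z zp] := @prim_root_closed C q (pchar_num _) qp.
have zq := prim_expr_order zp.
have squares (delta : k) (A : {poly k}) :
    (map_poly i A).[z] ^+ 2 = i delta -> exists x, delta = x ^+ 2.
  move=> Ad; apply: boolp.contrapT => nsq; apply: H; exists delta; split=> // E f e eq1 e1.
  exact: (square_transfer f qp zq eq1 e1 Ad).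
have [g [qg g_gen]] := primitive_root_mod qp.
have [t ot] : exists t u, (q.-1 = 2 ^ t * u)%N /\ odd u.
  have q10 : (0 < q.-1)%N by rewrite -subn1 subn_gt0 prime_gt1.
  have [u u2 eu] := pfactor_coprime (isT : prime 2) q10.
  by exists (logn 2 q.-1), u; rewrite mulnC -coprime2n.
case: ot => -[|u] [eu ou] //.
pose h := (g ^ (2 ^ t))%N.
have hu : z ^+ (h ^ u.+1) = z.
  apply/eqP; rewrite -[X in _ == X]expr1 (eq_prim_root_expr zp) -expnM -eu.
  by rewrite -(totient_prime qp) Euler_exp_totient // coprime_sym prime_coprime.
(* The product of y - 1/y for y running through z^(h^j), which the substitution of z^h for z
   permutes; the exponent q - 1 stands for -1. *)
pose beta : {poly k} := \prod_(j < u.+1) ('X^(h ^ j) - 'X^(q.-1 * h ^ j)).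
have evb y : (map_poly i beta).[y] = \prod_(j < u.+1) (y ^+ (h ^ j) - y ^+ (q.-1 * h ^ j)).
  rewrite rmorph_prod horner_prod; apply: eq_bigr => j _.
  by rewrite rmorphB /= !map_polyXn !hornerE.
have [c ec] : exists c, (map_poly i beta).[z] = i c.
  apply: (@fixed_in_base k C i q z g qp chk zp g_gen squares t) => b.
  rewrite -/h !evb big_ord_recr [RHS]big_ord_recl /= mulrC; congr (_ * _).
    have zb : (z ^+ (b * h)) ^+ (h ^ u) = z ^+ b.
      by rewrite -exprM -mulnA -expnS mulnC exprM hu.
    by rewrite expn0 muln1 expr1 zb (mulnC q.-1) exprM zb.
  apply: eq_bigr => j _; rewrite /bump /= add1n expnS -!exprM.
  by congr (z ^+ _ - z ^+ _); nia.
have zV n : (z ^+ n)^-1 = z ^+ (q.-1 * n).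
  have zn0 : z ^+ n != 0.
    apply: expf_neq0; apply: contra_eq_neq zq => ->.
    by rewrite expr0n eqn0Ngt q0 eq_sym oner_neq0.
  apply: (mulfI zn0); rewrite mulfV // -exprD -mulSn prednK // exprM zq expr1n.
  by [].
have cz n : conjc (z ^+ n) = z ^+ (q.-1 * n).
  by rewrite rmorphXn /= (conjc_unity_root q0 zq) exprVn zV.
have czV n : conjc (z ^+ (q.-1 * n)) = z ^+ n by rewrite -zV conjc_inv cz -zV invrK.
have : conjc (i c) = - i c.
  rewrite -ec evb rmorph_prod /=.
  under eq_bigr => j _.
    rewrite rmorphB /= cz czV -opprB -mulN1r. over.
  by rewrite big_split /= prodr_const card_ord -signr_odd ou expr1 mulN1r.
have -> : conjc (i c) = i c by exact: conjc_real.
move/eqP; rewrite -subr_eq0 opprK -mulr2n mulrn_eq0 => /orP[//|/eqP ic0].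
move/eqP: ec; rewrite ic0 evb prodf_seq_eq0 => /hasP[j _] /=.
rewrite subr_eq0 (eq_prim_root_expr zp) => /eqP e.
have qh : ~~ (q %| h ^ j)%N by rewrite -expnM Euclid_dvdX // negb_and qg.
have : (q %| 2 * h ^ j)%N.
  rewrite mul2n -addnn /dvdn -modnDmr e modnDmr -mulSn prednK // modnMr.
  by [].
rewrite Euclid_dvdM // (negPf qh) orbF => /dvdn_leq; rewrite leqNgt.
by move=> /(_ isT); case: (q) qo (prime_gt1 qp) => [|[|[|]]].
Qed.

(** * Degrees divisible by 4 *)

Lemma rat_root_nat (c : rat) (q N : nat) : (0 < q)%N -> c ^+ q = N%:R ->
  exists m, N = (m ^ q)%N.
Proof.
move=> q0 cN; exists `|numq c|%N.
have e : (`|numq c| ^ q = N * `|denq c| ^ q)%N.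
  have d0 : (denq c)%:~R != 0 :> rat by rewrite intr_eq0 denq_eq0.
  have e1 : (numq c)%:~R ^+ q = N%:R * (denq c)%:~R ^+ q :> rat.
    have -> : (numq c)%:~R = c * (denq c)%:~R :> rat.
      by apply: (canRL (divfK d0)); exact: divq_num_den.
    by rewrite exprMn cN.
  have e2 : numq c ^+ q = N%:Z * denq c ^+ q.
    by apply/eqP; rewrite -(eqr_int rat) rmorphM !rmorphXn /= e1.
  by have := congr1 absz e2; rewrite abszM !abszX.
have : (`|denq c| ^ q %| `|numq c| ^ q)%N by rewrite e dvdn_mull.
rewrite dvdn_pexp2r // => dn.
have := coprime_num_den c; rewrite /coprime (gcdn_idPr dn) => /eqP d1.
by rewrite e d1 exp1n muln1.
Qed.

(** With G = gcd(m, l), m = aG and l = bG, one gets a n = b^2 G, and coprimality makes a and G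
    divide each other. *)
Lemma coprime_mul_square (m n l : nat) : coprime m n -> (m * n = l ^ 2)%N ->
  exists x, m = (x ^ 2)%N.
Proof.
move=> cop e; exists (gcdn m l).
have [m0|m0] := posnP m.
  by move: e; rewrite m0 mul0n gcd0n => <-.
set G := gcdn m l; have G0 : (0 < G)%N by rewrite gcdn_gt0 m0.
pose a := (m %/ G)%N; pose b := (l %/ G)%N.
have ea : m = (a * G)%N by rewrite divnK ?dvdn_gcdl.
have eb : l = (b * G)%N by rewrite divnK ?dvdn_gcdr.
have cab : coprime a b.
  by rewrite /coprime -(eqn_pmul2r G0) mul1n muln_gcdl -ea -eb.
have e2 : (a * n = b ^ 2 * G)%N.
  apply/eqP; rewrite -(eqn_pmul2r G0) mulnAC -ea e {1}eb expnMn -mulnA mulnn.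
  by [].
have aG : (a %| G)%N.
  by rewrite -(Gauss_dvdr _ (coprimeXr 2 cab)) -e2 dvdn_mulr.
have Ga : (G %| a)%N.
  have cG : coprime G n by apply: coprime_dvdl cop; apply: dvdn_gcdl.
  by rewrite -(Gauss_dvdl _ cG) e2 dvdn_mull.
have -> : G = a by apply/eqP; rewrite eqn_dvd Ga.
by rewrite ea -mulnn; congr muln; apply/eqP; rewrite eqn_dvd Ga.
Qed.

Definition fermat (j : nat) : nat := (2 ^ (2 ^ j)).+1.

Lemma fermatS j : (fermat j.+1 = fermat j * (fermat j - 2) + 2)%N.
Proof.
rewrite /fermat expnS mulnC expnM; set x := (2 ^ 2 ^ j)%N.
have : (0 < x)%N by rewrite expn_gt0.
by rewrite -mulnn; nia.
Qed.

Lemma fermat_dvd i j : (i < j)%N -> (fermat i %| fermat j - 2)%N.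
Proof.
elim: j => // j IH; rewrite ltnS leq_eqVlt fermatS addnK => /orP[/eqP ->|/IH H].
  exact: dvdn_mulr.
exact: dvdn_mull.
Qed.

Lemma coprime_fermat i j : (i < j)%N -> coprime (fermat i) (fermat j).
Proof.
move=> /fermat_dvd H; rewrite /coprime.
have ge2 : (2 <= fermat j)%N by rewrite /fermat ltnS expn_gt0.
have : (gcdn (fermat i) (fermat j) %| 2)%N.
  have h : (gcdn (fermat i) (fermat j) %| fermat j - 2 + 2)%N by rewrite subnK // dvdn_gcdr.
  by rewrite -(dvdn_addr _ (dvdn_trans (dvdn_gcdl _ _) H)).
have : (gcdn (fermat i) (fermat j) %| fermat i)%N by exact: dvdn_gcdl.
have oF : odd (fermat i) by rewrite /fermat /= oddX /= orbF -lt0n expn_gt0.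
move=> d1 /(primeP (isT : prime 2)).2/pred2P[->//|e].
by move: d1; rewrite e dvdn2 oF.
Qed.

Lemma fermat_not_square j x : (0 < j)%N -> fermat j <> (x ^ 2)%N.
Proof.
case: j => // j _; rewrite /fermat expnS mulnC expnM; set y := (2 ^ 2 ^ j)%N => e.
have y0 : (0 < y)%N by rewrite expn_gt0.
have : (y < x)%N by rewrite -ltn_sqr -e.
have : (x < y.+1)%N by rewrite -ltn_sqr -e -[y.+1]addn1 sqrnD; lia.
by lia.
Qed.

(* Otherwise all fermat j.+2 become squares in k, up to the factor g.  For two of them the
   square roots have the same signs under all real embeddings, so their product has the
   same positive image under all of them, and is rational. *)
Lemma fermat_nonsquare (R : realType) (k : fieldExtType rat) (g : k) :
  totally_real R k -> g != 0 -> exists j,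
    ~ (exists x : k, (fermat j.+2)%:R = x ^+ 2) /\
    ~ (exists x : k, (fermat j.+2)%:R * g = x ^+ 2).
Proof.
move=> hk g0; have [D [r [D0 Hr]]] := real_embeddings hk.
apply: boolp.contrapT => H.
have ex j : exists xb : k * bool, xb.1 ^+ 2 = (fermat j.+2)%:R * g ^+ xb.2.
  have [[x ex]|nx] := boolp.EM (exists x : k, (fermat j.+2)%:R = x ^+ 2).
    by exists (x, false); rewrite expr0 mulr1.
  have [[x ex]|nx'] := boolp.EM (exists x : k, (fermat j.+2)%:R * g = x ^+ 2).
    by exists (x, true); rewrite expr1.
  by case: H; exists j.
have [X HX] := boolp.choice ex.
(* Data for the pigeonhole principle: whether the factor [g] occurs, and the signs of the root under
   the embeddings. *)
pose st j : bool * {ffun 'I_D -> bool} := ((X j).2, [ffun i => 0 < r i (X j).1]).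
have [j [j' [jj' sjj']]] : exists j j', (j < j')%N /\ st j = st j'.
  pose M := #|{: bool * {ffun 'I_D -> bool}}|.
  apply: boolp.contrapT => nost.
  have inj : injective (fun j : 'I_M.+1 => st j).
    move=> a b e; apply/val_inj/eqP; rewrite eqn_leq.
    by apply/andP; split; rewrite leqNgt; apply/negP => lt;
      apply: nost; [exists b, a|exists a, b].
  by have := leq_card _ inj; rewrite card_ord ltnn.
have n0 l : 0 < (fermat l.+2)%:R :> R by rewrite ltr0n.
have X0 l : (X l).1 != 0.
  rewrite -sqrf_eq0 HX mulf_neq0 ?expf_neq0 //.
  by apply/eqP => e; have := n0 l; rewrite -(rmorph_nat (r (Ordinal D0))) e rmorph0 ltxx.
have [eb es] : (X j).2 = (X j').2 /\ forall i, (0 < r i (X j).1) = (0 < r i (X j').1).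
  split; first by case: sjj'.
  by move=> i; case: sjj' => _ /ffunP/(_ i); rewrite !ffunE.
pose G := g ^+ (X j).2; have G0 : G != 0 by rewrite expf_neq0.
pose w := (X j).1 * (X j').1 / G.
have w2 : w ^+ 2 = (fermat j.+2 * fermat j'.+2)%N%:R.
  rewrite /w expr_div_n exprMn !HX -eb -/G natrM.
  by field.
have wpos i : 0 < r i w.
  have rG : 0 < r i G.
    have : 0 < r i (X j).1 ^+ 2 by rewrite lt_def sqr_ge0 sqrf_eq0 fmorph_eq0 X0.
    by rewrite -rmorphXn HX rmorphM rmorph_nat pmulr_rgt0.
  rewrite /w fmorph_div rmorphM divr_gt0 //.
  case: (ltP 0 (r i (X j).1)) (es i) => [s1|s1] s2.
    by rewrite mulr_gt0.
  have s1' : r i (X j).1 < 0 by rewrite lt_neqAle fmorph_eq0 X0.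
  have s2' : r i (X j').1 < 0.
    by rewrite lt_neqAle fmorph_eq0 X0 leNgt -s2.
  by rewrite -mulrNN mulr_gt0 ?oppr_gt0.
have [c ec] : exists c : rat, w = c%:A.
  apply: (Hr w (Num.sqrt (fermat j.+2 * fermat j'.+2)%N%:R)) => i.
  by rewrite -(rmorph_nat (r i)) -w2 rmorphXn sqrtr_sqr gtr0_norm.
have c2 : c ^+ 2 = (fermat j.+2 * fermat j'.+2)%N%:R.
  by apply: (fmorph_inj (in_alg k)); rewrite rmorphXn rmorph_nat /= -ec.
have [m em] := rat_root_nat (isT : (0 < 2)%N) c2.
have [x] := coprime_mul_square (coprime_fermat (jj' : (j.+2 < j'.+2)%N)) em.
exact: fermat_not_square.
Qed.

(* Here eta = z + 1/z for a root of unity z of order 2^s.  The next trace is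
   sqrt (2 + eta), and (1 + z)^(2^s) = - (2 + eta)^(2^(s-1)). *)
Lemma cyclotomic_2_tower (R : realType) (k : fieldType) (phi : {rmorphism k -> R}) (S : nat) :
  (2 <= S)%N -> exists s eta, [/\ (2 <= s <= S)%N, 0 <= phi eta,
    s = S \/ ~ (exists x, 2 + eta = x ^+ 2) &
    forall (E : fieldType) (f : {rmorphism k -> E}), (exists i : E, i ^+ 2 = -1) ->
      exists z : E, z ^+ (2 ^ s.-1) = -1 /\ z ^+ 2 + 1 = f eta * z].
Proof.
elim: S => // S IH; rewrite leq_eqVlt => /orP[/eqP <-|S2].
  exists 2%N, 0; split; rewrite ?rmorph0 //; first by left.
  move=> E f [i i2]; exists i; rewrite expn1 i2; split=> //.
  by rewrite rmorph0 mul0r addNr.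
have [s [eta [/andP[s2 sS] eta0 stop Hz]]] := IH S2.
case: stop => [es|stop]; last first.
  by exists s, eta; split=> //; [rewrite s2 leqW|right].
have [[x ex]|nx] := boolp.EM (exists x, 2 + eta = x ^+ 2); last first.
  by exists s, eta; split=> //; [rewrite s2 leqW|right].
(* The sign of [x] is free; a nonnegative image lets [x] serve as the next [eta]. *)
wlog x0 : x ex / 0 <= phi x.
  move=> W; have [|x0] := leP 0 (phi x); first exact: W.
  by apply: (W (- x)); rewrite ?sqrrN // rmorphN oppr_ge0 ltW.
have xn0 : x != 0.
  apply: contra_eq_neq ex => ->; rewrite expr0n /= -(fmorph_eq0 phi) rmorphD rmorph_nat.
  by rewrite gt_eqF // ltr_pwDl.
exists S.+1, x; split=> //; [by rewrite leqnn andbT ltnW|by left|].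
move=> E f Ei; have [z [zs ze]] := Hz E f Ei.
have fx0 : f x != 0 by rewrite fmorph_eq0.
(* Hence (1 + z) / x is a square root of z, and its trace turns out to be x. *)
have z1 : (1 + z) ^+ 2 = f x ^+ 2 * z.
  by rewrite -rmorphXn -ex rmorphD rmorph_nat mulrDl -ze; ring.
have y2 : ((1 + z) / f x) ^+ 2 = z.
  by rewrite expr_div_n z1 mulrAC divff ?mul1r // expf_neq0.
exists ((1 + z) / f x); split.
  have -> : (2 ^ S.+1.-1 = 2 * 2 ^ s.-1)%N.
    by rewrite -expnS es prednK // -es ltnW.
  by rewrite exprM y2.
by rewrite y2; field.
Qed.

Lemma completion_absv_nat (R : realType) (k : fieldType) (v : absolute_value R k) (kv : completion v) (n : nat) :
  compl_absv kv n%:R = v n%:R.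
Proof. by rewrite -(rmorph_nat (compl_emb kv)) compl_absv_emb. Qed.

Section LocalSquares.
Variables (R : realType) (K : fieldType) (w : absolute_value R K) (p : nat).
Hypothesis w_complete : complete w.
Hypothesis w2 : w 2 <= 1.
Hypothesis p_prime : prime p.
Hypothesis wp : w p%:R < 1.

Lemma hensel_unit (m : nat) (x u : int) : (0 < m)%N -> ~~ (p %| m)%N -> ~~ (p %| u)%Z ->
  (p %| x ^+ m - u)%Z -> exists y : K, y ^+ m = u%:~R.
Proof.
move=> m0 pm pu xu; have px : ~~ (p %| x)%Z.
  apply: contra pu => px; have -> : u = x ^+ m - (x ^+ m - u) by ring.
  by apply: rpredB => //; rewrite -(prednK m0) exprS dvdz_mulr.
by have [y yu _] := hensel_simple w_complete w2 p_prime wp pm px xu; exists y.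
Qed.

End LocalSquares.

(** At archimedean places n is a square. Otherwise the residue field characteristic p decides: for p
    = 2, n is 1 modulo 8; for odd p, either -1 or one of n and -n is a square modulo p, and Hensel's
    lemma lifts it. *)
Lemma fermat_local (R : realType) (k : fieldExtType rat) (v : absolute_value R k) (j : nat) :
  nontrivial v -> forall kv : completion v,
  (exists i : kv, i ^+ 2 = -1) \/
  exists y : kv, y ^+ 2 = (fermat j.+2)%:R \/ y ^+ 2 = - (fermat j.+2)%:R.
Proof.
move=> vn kv; have wc : complete (compl_absv kv) := @compl_complete _ _ _ kv.
have [v2|[v2 [p pp vp]]] := place_dichotomy vn.
  right; have [|//|y ey] := @archimedean_root R kv (compl_absv kv) wc 2 (fermat j.+2).
    by rewrite completion_absv_nat.
  by exists y; left.
have w2 : compl_absv kv 2 <= 1 by rewrite completion_absv_nat.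
have wp : compl_absv kv p%:R < 1 by rewrite completion_absv_nat.
pose n := fermat j.+2.
pose N : int := (2 ^ (2 ^ j.+1))%N%:Z.
have nN : n%:Z = N ^+ 2 + 1.
  rewrite /n /fermat -addn1 PoszD; congr (_ + _).
  by rewrite expr2 -PoszM -expnD addnn -mul2n -expnS.
have [p2|po] := even_prime pp.
  right; rewrite p2 in pp wp.
  (* The index of the Fermat number is at least 2, so that n is 1 modulo 8, as Hensel's lemma with
     [s = 1] requires. *)
  have e3 : ((2%:Z ^+ 3) %| 1 ^+ 2 - n%:Z)%Z.
    rewrite nN expr1n opprD addrCA subrr addr0 rpredN dvdzE !abszX /= -expnM.
    apply: dvdn_exp2l; rewrite expnS; have : (0 < 2 ^ j)%N by rewrite expn_gt0.
    by lia.
  have [//|//|//|//|y ey _] := @hensel_root R kv (compl_absv kv) wc w2 2 pp wp 2 1 1 1 n%:Z.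
  by exists y; left.
have p2' : ~~ (p %| 2)%N.
  by rewrite dvdn_prime2 //; apply: contraTneq po => ->.
have pm1 : ~~ (p %| -1)%Z.
  by rewrite dvdzE /= dvdn1 gtn_eqF // prime_gt1.
have [[x ex]|sq] := opp_square_mod pp po.
  left; have [y ey] := hensel_unit wc w2 pp wp (isT : (0 < 2)%N) p2' pm1 ex.
  by exists y; rewrite ey mulrN1z.
have [pn|pn] := boolP (p %| n%:Z)%Z.
  left; have ex : (p %| N ^+ 2 - (-1))%Z by rewrite opprK -nN.
  have [y ey] := hensel_unit wc w2 pp wp (isT : (0 < 2)%N) p2' pm1 ex.
  by exists y; rewrite ey mulrN1z.
right; have [x [ex|ex]] := sq n%:Z.
  have [y ey] := hensel_unit wc w2 pp wp (isT : (0 < 2)%N) p2' pn ex.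
  by exists y; left.
have pn' : ~~ (p %| - n%:Z)%Z by rewrite rpredN.
have [y ey] := hensel_unit wc w2 pp wp (isT : (0 < 2)%N) p2' pn' ex.
by exists y; right; rewrite ey mulrNz.
Qed.

Lemma expr_sign_eq (R : realDomainType) (x y : R) (n : nat) : (0 < n)%N ->
  x ^+ n = y ^+ n -> x = y \/ x = - y.
Proof.
move=> n0 e; have : `|x| = `|y|.
  by apply: (pexpIrn n0); rewrite ?nnegrE // -!normrX e.
by move/eqP; rewrite eqr_norm2 => /orP[] /eqP; [left|right].
Qed.

Lemma expr_pos_inj (R : realDomainType) (x y : R) (n : nat) : (0 < n)%N -> 0 <= x -> 0 <= y ->
  x ^+ n = y ^+ n -> x = y.
Proof. by move=> n0 x0 y0; apply: pexpIrn; rewrite ?nnegrE. Qed.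

Lemma hasse_failure_4 (R : realType) (k : fieldExtType rat) (d : nat) :
  (4 %| d)%N -> (0 < d)%N -> totally_real R k ->
  exists S : diagonal_surface k d, fails_Hasse_principle_for_lines R S.
Proof.
move=> d4 d0 hk; have [D [r [D0 _]]] := real_embeddings hk.
pose phi := r (Ordinal D0).
have inj := fmorph_inj phi.
have S2 : (2 <= logn 2 d)%N by rewrite -(pfactor_dvdn _ (isT : prime 2)).
have [s [eta [/andP[s2 sS] eta0 stop Hz]]] := cyclotomic_2_tower phi S2.
pose g := 2 + eta.
have g0 : 0 < phi g by rewrite rmorphD rmorph_nat ltr_pwDl.
have gn0 : g != 0 by rewrite -(fmorph_eq0 phi) gt_eqF.
have [j [nsq nsqg]] := fermat_nonsquare hk gn0.
set n := fermat j.+2 in nsq nsqg.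
have [e de] : exists e, d = (2 ^ s.-1 * 2 * e)%N.
  have /dvdnP[e ->] : (2 ^ s %| d)%N by rewrite (pfactor_dvdn _ (isT : prime 2)).
  by exists e; rewrite -expnSr prednK ?(ltnW s2) // mulnC.
(* Where -1 is a square, [(1 + z) ^+ 2 = g * z] shows that [a0] is (1 + z)^(2^s), and so [a] is
   [(1 + z) ^+ d]. *)
pose a0 : k := - (g ^+ (2 ^ s.-1)); pose a := a0 ^+ e.
(* As d/2 is even, this is a d-th power as soon as n or -n is a square. *)
pose c : k := n%:R ^+ d./2.
have d2 : d = (2 * d./2)%N.
  have od : ~~ odd d by rewrite -dvdn2; apply: dvdn_trans d4.
  by rewrite -[LHS]odd_double_half mul2n (negbTE od).
have hd0 : (0 < d./2)%N by lia.
have a2 : a ^+ 2 = g ^+ d.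
  by rewrite /a -exprM mulnC exprM /a0 sqrrN -!exprM de; congr (_ ^+ _); lia.
have n0 : 0 < n%:R :> R by rewrite ltr0n.
have nn0 : (n%:R : k) != 0 by rewrite -(fmorph_eq0 phi) rmorph_nat gt_eqF.
have posroot (x y : k) : 0 <= phi y -> y ^+ d./2 = x ^+ d -> y = x ^+ 2.
  move=> y0 e1; apply: inj; apply: (expr_pos_inj hd0) => //.
    by rewrite rmorphXn sqr_ge0.
  by rewrite -!rmorphXn e1 -exprM -d2.
apply: (@fails_Hasse_principle_criterion R k d a g c) => //.
- by move=> i; rewrite (pchar_lalg k) pchar_num.
- by rewrite dvdn_leq.
- by rewrite expf_neq0 // oppr_eq0 expf_neq0.
- by rewrite expf_neq0.
- case=> x ex; have e1 : g ^+ d = (x ^+ 2) ^+ d by rewrite -a2 ex -!exprM mulnC.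
  case: stop => [es|]; last first.
    case; exists x; apply: inj; apply: (expr_pos_inj d0) => //; first exact: ltW.
      by rewrite rmorphXn sqr_ge0.
    by rewrite -!rmorphXn -/g e1.
  (* Here 2^s is the exact power of 2 in d, so e is odd and [a] is negative under [phi], unlike any
     d-th power. *)
  have oe : odd e.
    have : ~~ (2 ^ s.+1 %| d)%N by rewrite (pfactor_dvdn _ (isT : prime 2)) // es ltnn.
    rewrite de -expnSr prednK ?(ltnW s2) // expnSr dvdn_pmul2l ?expn_gt0 // dvdn2.
    by rewrite negbK.
  have : phi a < 0.
    rewrite /a /a0 exprNn -signr_odd oe expr1 mulN1r rmorphN oppr_lt0 !rmorphXn.
    by rewrite !exprn_gt0.
  by rewrite ex d2 exprM rmorphXn rmorphXn -exprM mulnC exprM ltNge sqr_ge0.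
- case=> x ex; apply: nsq; exists x; apply: posroot ex.
  by rewrite rmorph_nat ltW.
- case=> x ex; apply: nsqg; exists (g * x).
  (* Squaring [c = - (x ^+ d * a)] gives n^d = (g x^2)^d, and both bases are nonnegative under
     [phi]. *)
  have e1 : n%:R = g * x ^+ 2.
    apply: inj; apply: (expr_pos_inj d0).
    - by rewrite rmorph_nat ltW.
    - by rewrite rmorphM rmorphXn mulr_ge0 ?sqr_ge0 ?ltW.
    have an0 : a != 0 by rewrite expf_neq0 // oppr_eq0 expf_neq0.
    have ec : c = - (x ^+ d * a) by rewrite -ex mulNr opprK divfK.
    have c2 : n%:R ^+ d = (x ^+ d * a) ^+ 2 by rewrite -sqrrN -ec /c -exprM mulnC -d2.
    rewrite -!(rmorphXn phi) c2 [in LHS]exprMn a2 [in RHS]exprMn -!exprM (mulnC d) mulrC.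
    by [].
  by rewrite e1; ring.
move=> v vn kv; have [Hi|[y Hy]] := fermat_local j vn kv.
  left; have [z [z1 z2]] := Hz _ (compl_emb kv) Hi.
  exists (1 + z).
  have e1 : (1 + z) ^+ 2 = compl_emb kv g * z.
    by rewrite rmorphD rmorph_nat mulrDl -z2; ring.
  rewrite de exprM (mulnC _ 2%N) exprM e1 exprMn z1 rmorphXn rmorphN rmorphXn mulrN1.
  by [].
right; exists y; rewrite rmorphXn rmorph_nat.
have [h2 eh2] : exists h, (d./2 = 2 * h)%N.
  by case/dvdnP: d4 => h; exists h; lia.
have -> : y ^+ d = (y ^+ 2) ^+ d./2 by rewrite -exprM -d2.
case: Hy => -> //.
by rewrite eh2 !exprM sqrrN.
Qed.

(** * Degrees that are twice an odd number *)

Lemma expr_odd_inj (R : realDomainType) (x y : R) (n : nat) : odd n ->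
  x ^+ n = y ^+ n -> x = y.
Proof.
move=> on e; have n0 : (0 < n)%N by case: n on e.
have [//|xy] := expr_sign_eq n0 e.
move: e; rewrite xy exprNn -signr_odd on expr1 mulN1r => /eqP.
rewrite -subr_eq0 -opprD oppr_eq0 -mulr2n mulrn_eq0 /= expf_eq0 n0 => /eqP ->.
by rewrite oppr0.
Qed.

(* Its prime factors are 1 mod q, and it is 1 mod q^3. *)
Definition cyclotomic_value (q : nat) : nat := \sum_(i < q) (q ^ q) ^ i.

Lemma cyclotomic_valueZ (A : nzRingType) (q : nat) :
  (cyclotomic_value q)%:R = \sum_(i < q) (q%:R ^+ q) ^+ i :> A.
Proof. by rewrite natr_sum; apply: eq_bigr => i _; rewrite !natrX. Qed.

(** With Q the given number and X = Q^(Q-1), the top term is X^Q and the others sum to less than Q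
    X^(Q-1), so the value lies strictly between X^Q and (X+1)^Q. *)
Lemma cyclotomic_value_not_power (q x : nat) : (2 <= q)%N -> cyclotomic_value q <> (x ^ q)%N.
Proof.
case: q => [|[|q]] // _; set Q := q.+2; pose M := (Q ^ Q)%N; pose X := (Q ^ Q.-1)%N.
have M0 : (0 < M)%N by rewrite expn_gt0.
have X0 : (0 < X)%N by rewrite expn_gt0.
have eV : (cyclotomic_value Q = \sum_(i < Q.-1) M ^ i + X ^ Q)%N.
  by rewrite /cyclotomic_value big_ord_recr /= /M /X -!expnM mulnC.
have sum0 : (0 < \sum_(i < Q.-1) M ^ i)%N by rewrite big_ord_recl expn0.
have sumle : (\sum_(i < Q.-1) M ^ i <= Q.-1 * M ^ q)%N.
  rewrite -[X in (_ <= X * _)%N]card_ord -sum_nat_const; apply: leq_sum => i _.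
  by rewrite leq_pexp2l // -ltnS.
have big : (X ^ Q + Q * X ^ Q.-1 <= X.+1 ^ Q)%N.
  have H m : (X ^ m.+1 + m.+1 * X ^ m <= X.+1 ^ m.+1)%N.
    elim: m => [|m IH]; first by rewrite expn0 !expn1 muln1 addn1.
    rewrite (expnS X.+1) (expnS X m.+1); apply: leq_trans (leq_mul (leqnn X.+1) IH).
    rewrite (expnS X m); set P := (X ^ m)%N; nia.
  exact: H.
have small : (Q.-1 * M ^ q < Q * X ^ Q.-1)%N.
  have -> : (X ^ Q.-1 = M ^ q * Q)%N.
    by rewrite /X /M -!expnM -expnSr; congr (Q ^ _)%N; rewrite /Q; lia.
  by rewrite mulnCA (mulnC Q.-1) ltn_pmul2l ?expn_gt0 ?M0 // /Q; nia.
move=> e.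
have l1 : (X < x)%N by rewrite -(@ltn_exp2r _ _ Q) // -e eV; lia.
have l2 : (x < X.+1)%N by rewrite -(@ltn_exp2r _ _ Q) // -e eV; lia.
by lia.
Qed.

(* All conjugates of a q-th root are real, hence equal, so that the root is rational. *)
Lemma nat_odd_root_rational (R : realType) (k : fieldExtType rat) (q n : nat) :
  totally_real R k -> odd q -> (exists y : k, n%:R = y ^+ q) -> exists m, n = (m ^ q)%N.
Proof.
move=> hk qo [y ey]; have [D [r [D0 Hr]]] := real_embeddings hk.
have [c ec] : exists c : rat, y = c%:A.
  apply: (Hr y (r (Ordinal D0) y)) => i; apply: (expr_odd_inj qo).
  by rewrite -!rmorphXn -ey !rmorph_nat.
apply: (@rat_root_nat c); first by case: q qo {ey}.
by apply: (fmorph_inj (in_alg k)); rewrite rmorphXn rmorph_nat /= -ec.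
Qed.

(** For p = q, the value is 1 modulo q^3 and Hensel's lemma applies. If q divides p - 1, a root of
    unity modulo p lifts. Otherwise every residue is a q-th power, and p does not divide the
    value. *)
Lemma cyclotomic_value_local (R : realType) (k : fieldExtType rat) (v : absolute_value R k) (q : nat) :
  prime q -> odd q -> nontrivial v -> forall kv : completion v,
  (exists z : kv, z ^+ q = 1 /\ z != 1) \/
  exists y : kv, y ^+ q = (cyclotomic_value q)%:R.
Proof.
move=> qp qo vn kv; have wc : complete (compl_absv kv) := @compl_complete _ _ _ kv.
have q0 := prime_gt0 qp; have q1 := prime_gt1 qp.
have q3 : (3 <= q)%N by case: (q) qo q1 => [|[|[|]]].
have [v2|[v2 [p pp vp]]] := place_dichotomy vn.
  right; have [|//|y ey] := @archimedean_root R kv (compl_absv kv) wc q (cyclotomic_value q).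
    by rewrite completion_absv_nat.
  by exists y.
have w2 : compl_absv kv 2 <= 1 by rewrite completion_absv_nat.
have wp : compl_absv kv p%:R < 1 by rewrite completion_absv_nat.
pose n := cyclotomic_value q; pose M : int := q%:Z ^+ q.
have nM : n%:Z = \sum_(i < q) M ^+ i by rewrite -[LHS]natz cyclotomic_valueZ natz.
have pN1 : ~~ (p %| 1)%Z by rewrite dvdzE /= dvdn1 gtn_eqF // prime_gt1.
have [epq|npq] := eqVneq p q.
  right; rewrite epq in pp wp pN1.
  have e3 : ((q%:Z ^+ 3) %| 1 ^+ q - n%:Z)%Z.
    have -> : n%:Z = 1 + \sum_(i < q.-1) M ^+ i.+1 
      by rewrite nM; case: (q) q0 => // t _; rewrite big_ord_recl.
    rewrite expr1n opprD addrA subrr add0r rpredN.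
    apply: rpred_sum => i _; rewrite exprS dvdz_mulr //.
    by rewrite /M -(subnK q3) addnC exprD dvdz_mulr.
  have [||//|//|y ey _] := @hensel_root R kv (compl_absv kv) wc w2 q pp wp q 1 1 1 n%:Z.
  - by rewrite muln1 expn1.
  - by rewrite dvdn1 gtn_eqF.
  by exists y.
have pq : ~~ (p %| q)%N by rewrite dvdn_prime2.
have [qp1|nqp1] := boolP (q %| p.-1)%N.
  left; have [x [x1 x2]] := unity_root_mod pp q1 qp1.
  have px : ~~ (p %| x)%Z.
    apply: contra pN1 => px.
    have : (p %| x ^+ q - (x ^+ q - 1))%Z.
      by apply: rpredB => //; rewrite -(prednK q0) exprS dvdz_mulr.
    by rewrite opprB addrC subrK.
  have [z z1 [X Xz Xx]] := hensel_simple wc w2 pp wp pq px x1.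
  exists z; split; first by rewrite z1.
  (* The approximations of z are congruent to x, not to 1, modulo p, so they stay at distance at
     least 1/2 from 1. *)
  apply/eqP => ez; have [N HN] := Xz (1 / 2) (ltac:(by rewrite divr_gt0)).
  have := HN N (leqnn N); rewrite ez ltNge => /negP[].
  have -> : (X N)%:~R - 1 = (X N - 1)%:~R :> kv by rewrite rmorphB.
  apply: (absv_ndvd w2 pp wp).
  apply: contra x2 => H; have -> : x - 1 = (X N - 1) - (X N - x) by ring.
  exact: rpredB.
right; have pn : ~~ (p %| n%:Z)%Z.
  (* Otherwise M^q, and hence M, would be 1 modulo p, so n would be congruent to q, which p does not
     divide. *)
  apply/negP => pn.
  have pM1 : (p %| M - 1)%Z.
    by apply: (unity_root_mod_eq1 pp qp nqp1); rewrite subrX1 -nM dvdz_mull.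
  have : (p %| n%:Z - (n%:Z - q%:Z))%Z.
    apply: rpredB => //.
    have -> : q%:Z = \sum_(i < q) 1 by rewrite sumr_const card_ord natz.
    rewrite nM -sumrB; apply: rpred_sum => i _.
    by rewrite subrX1 dvdz_mulr.
  by rewrite opprB addrC subrK dvdzE /= (negPf pq).
have [x ex] := power_mod pp qp nqp1 n%:Z.
have [y ey] := hensel_unit wc w2 pp wp q0 pq pn ex.
by exists y.
Qed.

Lemma hasse_failure_odd (R : realType) (k : fieldExtType rat) (m : nat) :
  odd m -> (1 < m)%N -> totally_real R k ->
  exists S : diagonal_surface k (2 * m), fails_Hasse_principle_for_lines R S.
Proof.
move=> om m1 hk; have [D [r [D0 _]]] := real_embeddings hk.
pose phi := r (Ordinal D0); have inj := fmorph_inj phi.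
pose q := pdiv m; have qp : prime q := pdiv_prime m1.
have qm : (q %| m)%N := pdiv_dvd m.
have qo : odd q := dvdn_odd qm om.
have q0 := prime_gt0 qp; have m0 := ltnW m1.
have [e em] : exists e, m = (q * e)%N by case/dvdnP: qm => e; exists e; rewrite mulnC.
have e0 : (0 < e)%N by move: m0; rewrite em muln_gt0 => /andP[].
have [delta [nsq Hd]] := quadratic_subcyclotomic phi qp qo.
have d0 : delta != 0.
  by apply/eqP => d0; apply: nsq; exists 0; rewrite d0 expr0n.
pose n := cyclotomic_value q.
have nroot : ~ exists y : k, n%:R = y ^+ q.
  by move=> /(nat_odd_root_rational hk qo)[x]; apply: cyclotomic_value_not_power; apply: prime_gt1.
have nn0 : (n%:R : k) != 0.
  by apply/eqP => n0; apply: nroot; exists 0; rewrite n0 expr0n eqn0Ngt q0.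
have e20 : (0 < 2 * e)%N by rewrite muln_gt0.
(* In a real embedding equal 2e-th powers have bases equal up to sign, and the odd q absorbs the
   sign. *)
have rootq (x y : k) : x ^+ (2 * e) = (y ^+ q) ^+ (2 * e) -> exists z, x = z ^+ q.
  move=> /(congr1 phi); rewrite [LHS]rmorphXn [RHS]rmorphXn => /(expr_sign_eq e20)[] H.
    by exists y; apply: inj.
  exists (- y); apply: inj; rewrite H exprNn -signr_odd qo expr1 mulN1r.
  by rewrite rmorphN.
pose a := delta ^+ m; pose c : k := n%:R ^+ (2 * e).
have a0 : a != 0 by rewrite expf_neq0.
apply: (@fails_Hasse_principle_criterion R k (2 * m) a delta c) => //.
- by move=> i; rewrite (pchar_lalg k) pchar_num.
- by lia.
- by rewrite expf_neq0.
- by rewrite /a -exprM mulnC.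
- case=> x ex; apply: nsq; exists x; apply: inj; apply: (expr_odd_inj om).
  by rewrite -!(rmorphXn phi) -exprM -ex.
- case=> x ex; apply: nroot; apply: (rootq _ x).
  by rewrite -exprM -/c ex em; congr (_ ^+ _); lia.
- case=> x ex; apply: nroot.
  have ec : c = - (x ^+ (2 * m) * a) by rewrite -ex mulNr opprK divfK.
  (* Squaring removes the sign of [- (c / a)] and leaves 2e-th powers on both sides. *)
  have c2 : (n%:R ^+ 2) ^+ (2 * e) = ((delta * x ^+ 2) ^+ q) ^+ (2 * e) :> k.
    rewrite -exprM mulnC exprM -/c ec sqrrN exprMn -!exprM exprMn -!exprM mulrC.
    by congr (_ ^+ _ * _ ^+ _); rewrite em; lia.
  have [W eW] := rootq _ _ c2.
  (* As n^2 = W^q, the quotient n = n^q / n^(q-1) is a q-th power. *)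
  exists (n%:R / W ^+ q./2); rewrite expr_div_n -exprM mulnC exprM -eW -exprM.
  have -> : n%:R ^+ q = n%:R * n%:R ^+ (2 * q./2) :> k.
    by rewrite -exprS -[in LHS](odd_double_half q) qo mul2n.
  by rewrite mulfK // expf_neq0.
move=> v vn kv; have [[z [z1 z2]]|[y Hy]] := cyclotomic_value_local qp qo vn kv.
  left; have [y ey] := Hd _ (compl_emb kv) z z1 z2; exists y.
  by rewrite rmorphXn ey -exprM.
right; exists y; rewrite rmorphXn rmorph_nat -Hy -exprM em.
by congr (_ ^+ _); lia.
Qed.

Theorem theorem1p4 (R : realType) (k : fieldExtType rat) (d : nat)
  (hd4 : (4 <= d)%N) (hd_even : ~~ odd d) (hk : totally_real R k) :
  exists S : diagonal_surface k d, fails_Hasse_principle_for_lines R S.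
Proof.
have [d4|nd4] := boolP (4 %| d)%N.
  by apply: hasse_failure_4 => //; apply: leq_trans hd4.
have ed : d = (2 * d./2)%N.
  by rewrite -[LHS]odd_double_half (negbTE hd_even) mul2n.
rewrite ed; apply: hasse_failure_odd => //; last by lia.
by apply: contraNT nd4 => oh; rewrite ed (@dvdn_pmul2l 2 2) // dvdn2.
Qed.
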